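(* Let $R$ be an integral domain. Then: (1) $R$ has $t$-finite character if and only if $R\langle X\rangle$ has finite character; (2) $R$ is a weakly Matlis P$v$MD if and only if $R\langle X\rangle$ is an $h$-local Prüfer domain; (3) $R$ is a strongly discrete P$v$MD if and only if $R\langle X\rangle$ is a strongly discrete Prüfer domain; (4) $R$ is a generalized Krull domain if and only if $R\langle X\rangle$ is a generalized Dedekind domain; (5) $R$ is an integrally closed $w$-divisorial domain if and only if $R\langle X\rangle$ is an integrally closed divisorial domain; (6) $R$ is an integrally closed $w$-stable domain if and only if $R\langle X\rangle$ is an integrally closed stable domain.
   Context: $R$ is an integral domain with quotient field $K\neq R$. For nonzero submodules $A,B$ of $K$, $(A:B)=\{x\in K: xB\subseteq A\}$; $E(I)=(I:I)$. For a nonzero fractional ideal $I$, $I_v=(R:(R:I))$ ($I$ divisorial if $I=I_v$), $I_t=\bigcup\{J_v: J\subseteq I\text{ nonzero finitely generated}\}$ ($I$ a $t$-ideal if $I=I_t$); $t$-primes are prime $t$-ideals; $t\text{-Max}(R)$ is the set of ideals maximal among proper $t$-ideals. $E_w=\bigcap_{M\in t\text{-Max}(R)}ER_M$; $w$-ideals satisfy $I=I_w$. For $f\in R[X]$, $c(f)$ is the ideal generated by its coefficients, and $R\langle X\rangle=R[X]_{N_t}$ with $N_t=\{f: c(f)_t=R\}$. $R$ has ($t$-)finite character if each nonzero element lies in finitely many maximal ($t$-maximal) ideals. $R$ is weakly Matlis if it has $t$-finite character and each $t$-prime lies in a unique $t$-maximal ideal; a domain is $h$-local if it has finite character and each nonzero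 prime lies in a unique maximal ideal. $R$ is a P$v$MD if $R_M$ is a valuation domain for each $M\in t\text{-Max}(R)$; a P$v$MD is strongly discrete if $(P^2)_t\neq P$ for each $t$-prime $P$; a Prüfer domain is strongly discrete if $P\neq P^2$ for each nonzero prime $P$. A generalized Krull domain is a strongly discrete P$v$MD with the ascending chain condition on radical $t$-ideals; a generalized Dedekind domain is a strongly discrete Prüfer domain with the ascending chain condition on radical ideals. A domain is divisorial if every nonzero ideal is divisorial; $R$ is $w$-divisorial if every $w$-ideal is divisorial. A domain $D$ is stable if every nonzero ideal $I$ satisfies $I((I:I):I)=(I:I)$; $R$ is $w$-stable if every $w$-ideal $I$ satisfies $(I(E(I):I))_w=E(I)$. *)

(* Defs.v *)
(* A domain D is represented as a subring (predicate) of its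
   quotient field F; submodules of F are predicates F -> Prop. *)
From HB Require Import structures.
From mathcomp Require Import all_boot all_order all_algebra.
From mathcomp Require Import fraction.
Set Implicit Arguments. Unset Strict Implicit. Unset Printing Implicit Defensive.
Import Order.TTheory GRing.Theory Num.Theory.
Local Open Scope ring_scope.

Section DomainNotions.
Variables (F : fieldType) (D : F -> Prop).

Definition peq (A B : F -> Prop) := forall x, A x <-> B x.
Definition psub (A B : F -> Prop) := forall x, A x -> B x.

Definition dmod (A : F -> Prop) :=
  [/\ A 0, (forall x y, A x -> A y -> A (x + y)) &
      (forall a x, D a -> A x -> A (a * x))].
Definition nonzero (A : F -> Prop) := exists x, A x /\ x != 0.

Definition colon (A B : F -> Prop) : F -> Prop :=
  fun x => forall b, B b -> A (x * b).
Definition Eend (I : F -> Prop) := colon I I.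

Definition span (s : seq F) : F -> Prop :=
  fun x => exists c : nat -> F, (forall i, D (c i)) /\
             x = \sum_(i < size s) c i * s`_i.
Definition mulm (A B : F -> Prop) : F -> Prop :=
  fun x => exists s : seq (F * F), (forall p, p \in s -> A p.1 /\ B p.2) /\
             x = \sum_(p <- s) p.1 * p.2.

Definition frac_ideal (I : F -> Prop) :=
  [/\ dmod I, nonzero I & exists d, D d /\ d != 0 /\ psub (fun x => I (d * x)) D].

Definition vcl (I : F -> Prop) := colon D (colon D I).
Definition tcl (I : F -> Prop) : F -> Prop :=
  fun x => exists s : seq F, (forall y, y \in s -> I y) /\
             (exists2 y, y \in s & y != 0) /\ vcl (span s) x.

Definition ideal (I : F -> Prop) := dmod I /\ psub I D.
Definition proper_ideal (I : F -> Prop) := ideal I /\ ~ I 1.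
Definition prime_ideal (P : F -> Prop) :=
  proper_ideal P /\ (forall a b, D a -> D b -> P (a * b) -> P a \/ P b).
Definition maximal_ideal (M : F -> Prop) :=
  proper_ideal M /\ (forall J, proper_ideal J -> psub M J -> psub J M).
Definition radical_ideal (I : F -> Prop) :=
  ideal I /\ (forall x n, D x -> I (x ^+ n.+1) -> I x).

Definition t_ideal (I : F -> Prop) := ideal I /\ nonzero I /\ peq (tcl I) I.
Definition t_prime (P : F -> Prop) := prime_ideal P /\ t_ideal P.
Definition t_maximal (M : F -> Prop) :=
  [/\ t_ideal M, ~ M 1 &
      (forall J, t_ideal J -> ~ J 1 -> psub M J -> psub J M)].

Definition extloc (E P : F -> Prop) : F -> Prop :=
  fun x => exists e s, E e /\ D s /\ ~ P s /\ x = e / s.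
Definition loc (P : F -> Prop) := extloc D P.

Definition wcl (E : F -> Prop) : F -> Prop :=
  fun x => forall M, t_maximal M -> extloc E M x.

Definition finitely_many (Q : (F -> Prop) -> Prop) :=
  exists s : seq (F -> Prop), forall M, Q M ->
    exists2 i, (i < size s)%N & peq M (nth (fun _ => False) s i).

Definition finite_character :=
  forall x, D x -> x != 0 -> finitely_many (fun M => maximal_ideal M /\ M x).
Definition t_finite_character :=
  forall x, D x -> x != 0 -> finitely_many (fun M => t_maximal M /\ M x).

Definition weakly_Matlis :=
  t_finite_character /\
  forall P, t_prime P ->
    (exists M, t_maximal M /\ psub P M) /\
    (forall M N, t_maximal M -> t_maximal N -> psub P M -> psub P N -> peq M N).
Definition h_local :=
  finite_character /\
  forall P, prime_ideal P -> nonzero P ->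
    (exists M, maximal_ideal M /\ psub P M) /\
    (forall M N, maximal_ideal M -> maximal_ideal N -> psub P M -> psub P N ->
       peq M N).

End DomainNotions.

Definition valuation {F : fieldType} (V : F -> Prop) :=
  forall x, x != 0 -> V x \/ V x^-1.

Section DomainClasses.
Variables (F : fieldType) (D : F -> Prop).

Definition PvMD := forall M, t_maximal D M -> valuation (loc D M).
Definition Prufer := forall M, maximal_ideal D M -> valuation (loc D M).

Definition strongly_discrete_PvMD :=
  PvMD /\ forall P, t_prime D P -> ~ peq (tcl D (mulm P P)) P.
Definition strongly_discrete_Prufer :=
  Prufer /\ forall P, prime_ideal D P -> nonzero P -> ~ peq (mulm P P) P.

Definition acc (Q : (F -> Prop) -> Prop) :=
  forall I : nat -> (F -> Prop), (forall n, Q (I n)) ->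
    (forall n, psub (I n) (I n.+1)) -> exists n, forall m, (n <= m)%N -> peq (I m) (I n).

Definition generalized_Krull :=
  strongly_discrete_PvMD /\ acc (fun I => radical_ideal D I /\ t_ideal D I).
Definition generalized_Dedekind :=
  strongly_discrete_Prufer /\ acc (radical_ideal D).

Definition integral_over (x : F) :=
  exists n (c : nat -> F), (forall i, D (c i)) /\
    x ^+ n.+1 + \sum_(i < n.+1) c i * x ^+ i = 0.
Definition integrally_closed := forall x, integral_over x -> D x.

Definition divisorial_domain :=
  forall I, ideal D I -> nonzero I -> peq (vcl D I) I.
Definition w_ideal (I : F -> Prop) := ideal D I /\ nonzero I /\ peq (wcl D I) I.
Definition w_divisorial := forall I, w_ideal I -> peq (vcl D I) I.

Definition stable_domain :=
  forall I, ideal D I -> nonzero I -> peq (mulm I (colon (Eend I) I)) (Eend I).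
Definition w_stable :=
  forall I, w_ideal I -> peq (wcl D (mulm I (colon (Eend I) I))) (Eend I).

End DomainClasses.

Notation tofrac := (@FracField.tofrac _).

Definition Rdom (R : idomainType) : {fraction R} -> Prop :=
  fun x => exists a : R, x = tofrac a.

Definition content (R : idomainType) (f : {poly R}) : {fraction R} -> Prop :=
  fun x => exists c : nat -> R, x = tofrac (\sum_(i < size f) c i * f`_i).

Definition Nt (R : idomainType) (g : {poly R}) :=
  peq (tcl (@Rdom R) (content g)) (@Rdom R).
Definition RangleX (R : idomainType) : {fraction {poly R}} -> Prop :=
  fun x => exists f g : {poly R}, Nt g /\ x = tofrac f / tofrac g.

(* Main.v *)
Require Import Defs.
From HB Require Import structures.
From mathcomp Require Import all_boot all_order all_algebra.
From mathcomp Require Import fraction generic_quotient.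
From mathcomp Require Import boolp classical_sets ring.
Require Import Defs.
Set Implicit Arguments. Unset Strict Implicit. Unset Printing Implicit Defensive.
Import GRing.Theory.
Local Open Scope ring_scope.

(* The maximal ideals of R<X> are exactly the extensions MR<X> of the t-maximal ideals M
   of R: if the coefficients of the polynomials of an ideal J generate an ideal with trivial
   t-closure, then finitely many of them do, and they occur together in one polynomial of J,
   which is then a unit of R<X>.  By Gauss' lemma R_M is a valuation ring iff the
   localization of R<X> at MR<X> is one, so R is a PvMD iff R<X> is Prufer.  In that case a
   polynomial generates the same ideal of R<X> as its coefficients, hence J = (J n R)R<X>
   for every ideal J of R<X>; together with IR<X> n R = I_w and w = t this identifies the
   nonzero ideals of R<X> with the t-ideals of R, compatibly with products, primes,
   radicals, v-closures and, after clearing denominators, with I(E(I) : I).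

   In (5) and (6) the PvMD and Prufer properties must first be obtained from integral
   closedness.  For a two-generated ideal J = (a, b) of an integrally closed domain the
   Cayley-Hamilton argument gives (J_w : J) = R, so either hypothesis forces
   (J(R : J))_w = R; then J is locally principal, i.e. each R_M is a valuation ring. *)

(** * Equality and inclusion of predicates; subrings *)

Lemma peq_eq (F : fieldType) (A B : F -> Prop) : peq A B -> A = B.
Proof. by move=> h; apply/funext => x; apply/propext. Qed.

Lemma peq_refl (F : fieldType) (A : F -> Prop) : peq A A.
Proof. by []. Qed.

Lemma psub_antisym (F : fieldType) (A B : F -> Prop) :
  psub A B -> psub B A -> A = B.
Proof. by move=> AB BA; apply: peq_eq => x; split; [exact: AB | exact: BA]. Qed.

Lemma psub_trans (F : fieldType) (A B C : F -> Prop) :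
  psub A B -> psub B C -> psub A C.
Proof. by move=> AB BC x /AB /BC. Qed.

Definition subring_pred (F : fieldType) (D : F -> Prop) :=
  [/\ D 1, (forall x y, D x -> D y -> D (x - y)) &
      (forall x y, D x -> D y -> D (x * y))].

(** * Submodules, v- and t-closure, t-maximal ideals *)

Section Modules.
Variables (F : fieldType) (D : F -> Prop).
Hypothesis hD : subring_pred D.

Lemma subring1 : D 1. Proof. by case: hD. Qed.
Lemma subringB x y : D x -> D y -> D (x - y). Proof. by case: hD => _ + _; exact. Qed.
Lemma subringM x y : D x -> D y -> D (x * y). Proof. by case: hD => _ _; exact. Qed.
Lemma subring0 : D 0.
Proof. by rewrite -(subrr 1); apply: subringB; exact: subring1. Qed.
Lemma subringN x : D x -> D (- x).
Proof. by move=> Dx; rewrite -sub0r; exact: subringB subring0 Dx. Qed.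
Lemma subringD x y : D x -> D y -> D (x + y).
Proof. by move=> Dx /subringN; rewrite -{2}(opprK y); exact: subringB. Qed.
Lemma subringX x n : D x -> D (x ^+ n).
Proof.
move=> Dx; elim: n => [|n IH]; first by rewrite expr0; exact: subring1.
by rewrite exprS; exact: subringM.
Qed.

Lemma dmod_self : dmod D D.
Proof. by split; [exact: subring0 | exact: subringD | exact: subringM]. Qed.

Section Closure.
Variable A : F -> Prop.
Hypothesis hA : dmod D A.

Lemma dmod0 : A 0. Proof. by case: hA. Qed.
Lemma dmodD x y : A x -> A y -> A (x + y). Proof. by case: hA => _ + _; exact. Qed.
Lemma dmodM a x : D a -> A x -> A (a * x). Proof. by case: hA => _ _; exact. Qed.
Lemma dmodN x : A x -> A (- x).
Proof. by rewrite -mulN1r; apply: dmodM; apply/subringN/subring1. Qed.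
Lemma dmodB x y : A x -> A y -> A (x - y).
Proof. by move=> Ax /dmodN; exact: dmodD. Qed.

Lemma dmod_sum (I : Type) (r : seq I) (P : pred I) (f : I -> F) :
  (forall i, P i -> A (f i)) -> A (\sum_(i <- r | P i) f i).
Proof. by move=> h; apply: (big_ind A) => //; [exact: dmod0 | exact: dmodD]. Qed.

Lemma dmod_sum_seq (I : eqType) (r : seq I) (f : I -> F) :
  (forall i, i \in r -> A (f i)) -> A (\sum_(i <- r) f i).
Proof. by move=> h; rewrite big_seq; exact: dmod_sum. Qed.

End Closure.

Lemma dmod_colon A B : dmod D A -> dmod D (colon A B).
Proof.
move=> hA; split=> [b _|x y Ax Ay b Bb|a x Da Ax b Bb].
- by rewrite mul0r; exact: dmod0.
- by rewrite mulrDl; apply: dmodD => //; [exact: Ax | exact: Ay].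
- by rewrite -mulrA; apply: dmodM => //; exact: Ax.
Qed.

Lemma mulm_mem (A B : F -> Prop) a b : A a -> B b -> mulm A B (a * b).
Proof.
move=> Aa Bb; exists [:: (a, b)]; split; last by rewrite big_seq1.
by move=> p; rewrite inE => /eqP ->.
Qed.

Lemma dmod_mulm A B : dmod D A -> dmod D (mulm A B).
Proof.
move=> hA; split.
- by exists [::]; rewrite big_nil.
- move=> x y [s [hs ->]] [t [ht ->]]; exists (s ++ t); rewrite big_cat; split=> // p.
  by rewrite mem_cat => /orP[/hs|/ht].
- move=> a x Da [s [hs ->]]; exists [seq (a * p.1, p.2) | p <- s]; split.
    by move=> _ /mapP[p /hs[Ap Bp] ->] /=; split=> //; exact: dmodM.
  by rewrite big_map mulr_sumr; apply: eq_bigr => p _; rewrite mulrA.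
Qed.

Lemma mulm_sub (A B C : F -> Prop) : dmod D C ->
  (forall a b, A a -> B b -> C (a * b)) -> psub (mulm A B) C.
Proof.
by move=> hC h x [s [hs ->]]; apply: (dmod_sum_seq hC) => p /hs[? ?]; exact: h.
Qed.

Lemma dmod_span s : dmod D (span D s).
Proof.
split.
- exists (fun=> 0); split=> [_|]; first exact: subring0.
  by rewrite big1 // => i _; rewrite mul0r.
- move=> _ _ [c [hc ->]] [d [hd ->]]; exists (fun i => c i + d i); split.
    by move=> i; exact: subringD.
  by rewrite -big_split; apply: eq_bigr => i _; rewrite mulrDl.
- move=> a _ Da [c [hc ->]]; exists (fun i => a * c i); split.
    by move=> i; exact: subringM.
  by rewrite mulr_sumr; apply: eq_bigr => i _; rewrite mulrA.
Qed.

Lemma mem_span s x : x \in s -> span D s x.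
Proof.
move=> xs; exists (fun i => (i == index x s)%:R); split.
  by move=> i; case: eqP => _; [exact: subring1 | exact: subring0].
have ix : (index x s < size s)%N by rewrite index_mem.
rewrite (bigD1 (Ordinal ix)) //= eqxx mul1r nth_index // big1 ?addr0 // => i ni.
by rewrite (_ : _ == _ = false) ?mul0r //; apply/negbTE.
Qed.

Lemma span_sub s (A : F -> Prop) :
  dmod D A -> (forall x, x \in s -> A x) -> psub (span D s) A.
Proof.
move=> hA h _ [c [hc ->]]; apply: (dmod_sum hA) => i _.
by apply: dmodM => //; apply: h; exact: mem_nth.
Qed.

(** For b in (D : B), the element x b lies in (D : A), so y sends it into D. Taking x = 1 yields
    monotonicity and idempotence together; the t-closure and [lclos] get analogous lemmas. *)
Lemma vcl_mul (A B : F -> Prop) x y : vcl D A y ->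
  (forall a, A a -> vcl D B (x * a)) -> vcl D B (x * y).
Proof.
move=> Ay h b Bb; rewrite -mulrA mulrCA; apply: Ay => a Aa.
by rewrite mulrAC; exact: h.
Qed.

Lemma vcl_sub (A B : F -> Prop) : psub A (vcl D B) -> psub (vcl D A) (vcl D B).
Proof.
move=> AB y Ay; rewrite -(mul1r y); apply: vcl_mul Ay _ => a Aa.
by rewrite mul1r; exact: AB.
Qed.

Lemma sub_vcl (A : F -> Prop) : psub A (vcl D A).
Proof. by move=> x Ax b; rewrite mulrC; exact. Qed.

Lemma vcl_sub_ring (A : F -> Prop) : psub A D -> psub (vcl D A) D.
Proof.
by move=> AD x /(_ 1); rewrite mulr1; apply=> a Aa; rewrite mul1r; exact: AD.
Qed.

Lemma dmod_vcl (A : F -> Prop) : dmod D (vcl D A).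
Proof. exact: dmod_colon dmod_self. Qed.

(** The t-closure has finite type: the finite witnesses of the elements of s are concatenated into
    one list. The nonzero element of B serves the case of empty s, since [tcl] asks for a nonzero
    generator. *)
Lemma tcl_span s (B : F -> Prop) : nonzero B -> (forall y, y \in s -> tcl D B y) ->
  exists t, [/\ forall y, y \in t -> B y, exists2 y, y \in t & y != 0 &
                psub (span D s) (vcl D (span D t))].
Proof.
move=> [b [Bb b0]]; elim: s => [_|x s IH h].
  exists [:: b]; split; [by move=> y; rewrite inE => /eqP -> | by exists b; rewrite ?inE |].
  by apply: span_sub => //; exact: dmod_vcl.
have [|t [tB [y yt y0] st]] := IH; first by move=> y ys; apply: h; rewrite inE ys orbT.
have [u [uB [_ xu]]] := h x (mem_head _ _).
exists (u ++ t); split.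
- by move=> z; rewrite mem_cat => /orP[/uB|/tB].
- by exists y => //; rewrite mem_cat yt orbT.
have mono v : {subset v <= u ++ t} -> psub (vcl D (span D v)) (vcl D (span D (u ++ t))).
  move=> vut; apply: vcl_sub => z /(span_sub (dmod_span (u ++ t))) h'; apply: sub_vcl.
  by apply: h' => w /vut; exact: mem_span.
apply: span_sub; first exact: dmod_vcl.
move=> z; rewrite inE => /orP[/eqP ->|zs].
  by apply: mono xu => w wu; rewrite mem_cat wu.
apply: mono (st _ (mem_span zs)) => w wt; by rewrite mem_cat wt orbT.
Qed.

Lemma tcl_mul (A B : F -> Prop) x y : nonzero B -> tcl D A y ->
  (forall a, A a -> tcl D B (x * a)) -> tcl D B (x * y).
Proof.
move=> B0 [s [sA [_ ys]]] h.
have [|t [tB t0 st]] := @tcl_span [seq x * a | a <- s] B B0.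
  by move=> _ /mapP[a /sA Aa ->]; exact: h.
exists t; split=> //; split=> //; apply: vcl_mul ys _.
suff : psub (span D s) (fun a => vcl D (span D t) (x * a)) by [].
apply: span_sub => [|a sa]; last by apply/st/mem_span/map_f.
have [v0 vD vM] := dmod_vcl (span D t).
split=> [|a b ? ?|a b ? ?]; first by rewrite mulr0.
  by rewrite mulrDr; exact: vD.
by rewrite mulrCA; exact: vM.
Qed.

Lemma sub_tcl (A : F -> Prop) : nonzero A -> psub A (tcl D A).
Proof.
move=> [b [Ab b0]] x Ax; exists [:: x; b]; split.
  by move=> y; rewrite !inE => /orP[] /eqP ->.
split; first by exists b; rewrite ?inE ?eqxx ?orbT.
by apply/sub_vcl/mem_span/mem_head.
Qed.

Lemma tcl_sub (A B : F -> Prop) : nonzero B -> psub A (tcl D B) ->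
  psub (tcl D A) (tcl D B).
Proof.
move=> B0 AB y Ay; rewrite -(mul1r y); apply: tcl_mul Ay _ => // a Aa.
by rewrite mul1r; exact: AB.
Qed.

Lemma tcl_sub_ring (A : F -> Prop) : psub A D -> psub (tcl D A) D.
Proof.
move=> AD x [s [sA [_]]]; apply: vcl_sub_ring; apply: span_sub => [|y /sA].
  exact: dmod_self.
exact: AD.
Qed.

Lemma nonzero_sub (A B : F -> Prop) : psub A B -> nonzero A -> nonzero B.
Proof. by move=> AB [a [Aa a0]]; exists a; split=> //; exact: AB. Qed.

Lemma dmod_tcl (A : F -> Prop) : nonzero A -> dmod D (tcl D A).
Proof.
move=> A0; have [a0 [Aa0 a00]] := A0; split.
- exists [:: a0]; split; first by move=> y; rewrite inE => /eqP ->.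
  by split; [exists a0; rewrite ?inE | exact: dmod0 (dmod_vcl _)].
- move=> x y tx ty; have [|t [tA t0 st]] := @tcl_span [:: x; y] A A0.
    by move=> z; rewrite !inE => /orP[] /eqP ->.
  exists t; split=> //; split=> //; apply: st.
  by apply: dmodD; first exact: dmod_span; apply: mem_span; rewrite !inE eqxx ?orbT.
- move=> d x Dd tx; apply: (tcl_mul A0 tx) => a Aa.
  exists [:: a; a0]; split.
    by move=> y; rewrite !inE => /orP[] /eqP ->.
  split; first by exists a0; rewrite ?inE ?eqxx ?orbT.
  apply: sub_vcl; apply: dmodM Dd _; first exact: dmod_span.
  exact/mem_span/mem_head.
Qed.

Lemma t_ideal_tcl (A : F -> Prop) : psub A D -> nonzero A -> t_ideal D (tcl D A).
Proof.
move=> AD A0; have tA0 := nonzero_sub (sub_tcl A0) A0.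
split; first by split; [exact: dmod_tcl | exact: tcl_sub_ring].
by split=> // x; split; [exact: tcl_sub | exact: sub_tcl].
Qed.

(** The list s may consist of zeros only, so a nonzero element of J is added to it before J = J_t is
    applied. *)
Lemma t_ideal_not1 (J : F -> Prop) s : t_ideal D J -> ~ J 1 ->
  (forall y, y \in s -> J y) -> ~ vcl D (span D s) 1.
Proof.
move=> [_ [[b [Jb b0]] tJ]] J1 sJ v1; apply/J1/tJ; exists (b :: s); split.
  by move=> y; rewrite inE => /orP[/eqP ->|/sJ].
split; first by exists b; rewrite ?mem_head.
apply: vcl_sub v1 => x /(span_sub (dmod_span (b :: s))) h; apply/sub_vcl/h => y ys.
by apply: mem_span; rewrite inE ys orbT.
Qed.

(** That a t-closure misses 1 is a condition on finite subsets, so it passes to unions of chains and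
    Zorn's lemma applies. *)
Lemma exists_t_maximal (I : F -> Prop) : t_ideal D I -> ~ I 1 ->
  exists M, t_maximal D M /\ psub I M.
Proof.
move=> tI I1; have [[_ ID] [I0 _]] := tI.
(* A set B is admissible if no finite subset of the union of I and B has 1 in its v-closure. Since I
   enters the condition itself, the empty set is admissible, which settles the empty chain. *)
pose P (B : set F) := (forall x, B x -> D x) /\
  forall s : seq F, (forall y, y \in s -> I y \/ B y) -> ~ vcl D (span D s) 1.
have P0 : P (fun=> False).
  by split=> // s sI; apply: t_ideal_not1 tI I1 _ => y /sI[].
have [C CP totC|A [[AD Afin] Amax]] := @Zorn_bigcup F P.
  split=> [x [B /CP[BD _]]|s sC]; first exact: BD.
  suff [B [PB sB]] : exists B, P B /\ forall y, y \in s -> I y \/ B y by apply: PB.2 sB.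
  have [B []] : exists B, (C B \/ B = (fun=> False)) /\ forall y, y \in s -> I y \/ B y.
    elim: s sC => [_|x s IH h]; first by exists (fun=> False); split => //; right.
    have [|B [CB sB]] := IH; first by move=> y ys; apply: h; rewrite inE ys orbT.
    have [Ix|[B' CB' B'x]] := h x (mem_head _ _).
      exists B; split=> // y; rewrite inE => /orP[/eqP ->|/sB //]; by left.
    have [B'' [CB'' BB'' B'B'']] :
        exists B'', [/\ C B'', psub B B'' & psub B' B''].
      case: CB => [CB|->]; last by exists B'; split.
      by have [BB'|B'B] := totC _ _ CB CB'; [exists B' | exists B]; split.
    exists B''; split; first by left.
    move=> y; rewrite inE => /orP[/eqP ->|/sB[Iy|By]]; [right|left|right] => //.
      exact: B'B''.
    exact: BB''.
  by move=> [CB|->] sB; [exists B | exists (fun=> False)]; split => //; exact: CP.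
pose M x := I x \/ A x.
have M0 : nonzero M by case: I0 => b [Ib b0]; exists b; split=> //; left.
have MD : psub M D by move=> x [/ID|/AD].
(* The t-closure of the union M of I and A is admissible as well: finitely many of its elements lie
   in the v-closure of finitely many elements of M. Maximality then gives A = M_t. *)
have PtM : P (tcl D M).
  split=> [x|s sM]; first exact: tcl_sub_ring.
  have [y|t [tM _ st]] := @tcl_span s M M0.
    by move=> /sM[Iy|//]; apply: sub_tcl => //; left.
  by move=> /(vcl_sub st); exact: Afin.
have AtM : psub A (tcl D M) by move=> x Ax; apply: sub_tcl => //; right.
have tMA : psub (tcl D M) A.
  by apply: contrapT => h; apply: (Amax (tcl D M)) PtM; split.
have AE : A = tcl D M by exact: psub_antisym.
have IA : psub I A by move=> x Ix; apply/tMA/sub_tcl => //; left.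
exists A; split=> //; split.
- by rewrite AE; exact: t_ideal_tcl.
- move=> A1; apply: (Afin [:: 1]) => [y|]; first by rewrite inE => /eqP ->; right.
  exact/sub_vcl/mem_span/mem_head.
- move=> J tJ J1 AJ; apply: contrapT => h; apply: (Amax J); first by split.
  split=> [x|s sJ]; first by case: tJ => [[_ JD] _]; exact: JD.
  by apply: t_ideal_not1 tJ J1 _ => y /sJ[/IA/AJ|].
Qed.

(** If a is outside M, the t-closure of M together with a contains 1. When a b lies in M,
    multiplication by b carries that set into M, so b = b 1 lies in M_t = M. *)
Lemma t_maximal_prime M : t_maximal D M -> prime_ideal D M.
Proof.
move=> [tM M1 maxM]; have [idM [M0 tclM]] := tM; have [dM MD] := idM.
split=> // a b Da Db Mab; apply: contrapT => /not_orP[Ma Mb].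
pose N x := M x \/ x = a.
have ND : psub N D by move=> x [/MD|->].
have N0 : nonzero N by apply: nonzero_sub M0 => x; left.
have MN : psub M (tcl D N) by move=> x Mx; apply: sub_tcl => //; left.
have tN1 : tcl D N 1.
  apply: contrapT => h; apply: Ma; apply: (maxM _ (t_ideal_tcl ND N0) h MN).
  by apply: sub_tcl => //; right.
apply: Mb; apply/tclM; rewrite -(mulr1 b); apply: tcl_mul tN1 _ => // c Nc.
apply: sub_tcl => //; case: Nc => [Mc|->]; first exact: dmodM.
by rewrite mulrC.
Qed.

Lemma prime_mulN P a b : prime_ideal D P -> D a -> D b -> ~ P a -> ~ P b -> ~ P (a * b).
Proof. by move=> [_ h] Da Db Pa Pb /(h _ _ Da Db)[]. Qed.

Lemma extlocP (A P : F -> Prop) x : P 0 ->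
  extloc D A P x <-> exists s, [/\ D s, ~ P s & A (s * x)].
Proof.
move=> P0; have nz s : ~ P s -> s != 0 by move=> h; apply/eqP => s0; apply: h; rewrite s0.
split=> [[e [s [Ae [Ds [Ps ->]]]]]|[s [Ds Ps As]]].
  by exists s; split=> //; rewrite mulrC divfK // nz.
by exists (s * x), s; do !split=> //; rewrite mulrAC divff ?mul1r // nz.
Qed.

End Modules.

(** * Closure along a family of localizations *)

(** One closure serves both rings: with T the t-maximal ideals of R it is the w-closure, and with T
    the maximal ideals of R<X> it fixes every submodule ([lclos_maximal]). *)
Definition lclos (F : fieldType) (D : F -> Prop) (T : (F -> Prop) -> Prop)
  (A : F -> Prop) : F -> Prop := fun x => forall M, T M -> extloc D A M x.

Section Localization.
Variables (F : fieldType) (D : F -> Prop).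
Hypothesis hD : subring_pred D.

Lemma prime0 P : prime_ideal D P -> P 0.
Proof. by move=> [[[[P0 _ _] _] _] _]. Qed.

Lemma notin_neq0 P s : prime_ideal D P -> ~ P s -> s != 0.
Proof. by move=> /prime0 P0 Ps; apply/eqP => s0; apply: Ps; rewrite s0. Qed.

Lemma locP P x : prime_ideal D P ->
  loc D P x <-> exists s, [/\ D s, ~ P s & D (s * x)].
Proof. by move=> /prime0; exact: extlocP. Qed.

Lemma sub_loc P : prime_ideal D P -> psub D (loc D P).
Proof.
move=> pP x Dx; apply/(locP _ pP); exists 1; rewrite mul1r; split=> //.
  exact: subring1.
by case: pP => [[]].
Qed.

Lemma loc_subring P : prime_ideal D P -> subring_pred (loc D P).
Proof.
move=> pP; split.
- by apply: sub_loc => //; exact: subring1.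
- move=> x y /(locP _ pP)[s [Ds Ps sx]] /(locP _ pP)[t [Dt Pt ty]].
  apply/(locP _ pP); exists (s * t); split; [exact: subringM | exact: prime_mulN pP _ _ _ _|].
  have -> : s * t * (x - y) = t * (s * x) - s * (t * y) by ring.
  by apply: subringB => //; exact: subringM.
- move=> x y /(locP _ pP)[s [Ds Ps sx]] /(locP _ pP)[t [Dt Pt ty]].
  apply/(locP _ pP); exists (s * t); split; [exact: subringM | exact: prime_mulN pP _ _ _ _|].
  have -> : s * t * (x * y) = (s * x) * (t * y) by ring.
  exact: subringM.
Qed.

Lemma valuation_integrally_closed (V : F -> Prop) x :
  subring_pred V -> psub D V -> valuation V -> integral_over D x -> V x.
Proof.
move=> hV DV valV [n [c [Dc eqx]]]; have [->|x0] := eqVneq x 0; first exact: subring0.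
have [//|Vx] := valV _ x0.
(* Dividing the integral equation by x^n writes x as a polynomial in x^-1, which lies in V. *)
have -> : x = - \sum_(i < n.+1) c i * x^-1 ^+ (n - i).
  apply: (mulIf (expf_neq0 n x0)); rewrite -exprS.
  move/eqP: eqx; rewrite addr_eq0 => /eqP ->; rewrite mulNr mulr_suml; congr (- _).
  apply: eq_bigr => i _; rewrite -mulrA; congr (_ * _).
  have -> : x ^+ n = x ^+ (n - i) * x ^+ i by rewrite -exprD subnK // -ltnS.
by rewrite mulrA -exprMn mulVf // expr1n mul1r.
apply: subringN => //; apply: (dmod_sum (dmod_self hV)) => i _.
by apply: subringM => //; [exact: DV | exact: subringX].
Qed.

(** Over a valuation ring a finite set generates the ideal of one of its elements a. Induction on s:
    the new element is compared with the current a, and u collects the denominators met on the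
    way. *)
Lemma valuation_divisor M (s : seq F) : prime_ideal D M -> valuation (loc D M) ->
  (exists2 y, y \in s & y != 0) ->
  exists a u, [/\ a \in s, a != 0, D u, ~ M u & forall b, b \in s -> D (u * b / a)].
Proof.
move=> pM valM; have D1 := subring1 hD; have M1 : ~ M 1 by case: pM => [[]].
elim: s => [[y]//|x s IH xs].
have [[y ys y0]|s0] := EM (exists2 y, y \in s & y != 0); last first.
  have s00 b : b \in s -> b = 0.
    by move=> bs; apply: contrapT => /eqP b0; apply: s0; exists b.
  have x0 : x != 0.
    by case: xs => y; rewrite inE => /orP[/eqP ->//|/s00 ->]; rewrite eqxx.
  exists x, 1; rewrite mem_head; split=> // b; rewrite inE mul1r => /orP[/eqP ->|/s00 ->].
    by rewrite divff.
  by rewrite mul0r; exact: subring0.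
have [|a [u [sa a0 Du Mu ha]]] := IH; first by exists y.
have [x0|x0] := eqVneq x 0.
  exists a, u; rewrite inE sa orbT; split=> // b; rewrite inE => /orP[/eqP ->|/ha //].
  by rewrite x0 mulr0 mul0r; exact: subring0.
have [] := valM (x / a); first by rewrite mulf_neq0 ?invr_eq0.
  move=> /(locP _ pM)[t [Dt Mt tx]]; exists a, (u * t); rewrite inE sa orbT.
  split=> //; [exact: subringM | exact: prime_mulN pM _ _ _ _|].
  move=> b; rewrite inE => /orP[/eqP ->|/ha hb].
    by rewrite -!mulrA; exact: subringM.
  by rewrite (_ : _ / a = t * (u * b / a)); [exact: subringM | ring].
rewrite invf_div => /(locP _ pM)[t [Dt Mt tx]]; exists x, (u * t); rewrite mem_head.
split=> //; [exact: subringM | exact: prime_mulN pM _ _ _ _|].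
move=> b; rewrite inE => /orP[/eqP ->|/ha hb].
  by rewrite mulfK //; exact: subringM.
rewrite (_ : _ / x = (u * b / a) * (t * (a / x))); first exact: subringM.
by field; rewrite a0 x0.
Qed.

Section Family.
Variable T : (F -> Prop) -> Prop.
Hypothesis hT : forall M, T M -> prime_ideal D M.
Local Notation lclos := (lclos D T).

Lemma lclosP A x :
  lclos A x <-> forall M, T M -> exists s, [/\ D s, ~ M s & A (s * x)].
Proof.
split=> h M TM; first exact/(extlocP _ _ _ (prime0 (hT TM)))/h.
exact/(extlocP _ _ _ (prime0 (hT TM)))/h.
Qed.

Lemma sub_lclos A : psub A (lclos A).
Proof.
move=> x Ax; apply/lclosP => M /hT[[_ M1] _]; exists 1; rewrite mul1r; split=> //.
exact: subring1.
Qed.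

Lemma lclos_mul A B x y : lclos A y -> (forall a, A a -> lclos B (x * a)) ->
  lclos B (x * y).
Proof.
move=> Ay h; apply/lclosP => M TM; have [s [Ds Ms As]] := (lclosP _ _).1 Ay M TM.
have [t [Dt Mt Bt]] := (lclosP _ _).1 (h _ As) M TM.
exists (t * s); split; [exact: subringM | exact: prime_mulN (hT TM) _ _ _ _|].
by rewrite (_ : t * s * _ = t * (x * (s * y))) //; ring.
Qed.

Lemma lclos_sub A B : psub A (lclos B) -> psub (lclos A) (lclos B).
Proof.
move=> AB y Ay; rewrite -(mul1r y); apply: lclos_mul Ay _ => a Aa.
by rewrite mul1r; exact: AB.
Qed.

Lemma dmod_lclos A : dmod D A -> dmod D (lclos A).
Proof.
move=> hA; split.
- exact/sub_lclos/(dmod0 hA).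
- move=> x y Ax Ay; apply/lclosP => M TM.
  have [s [Ds Ms As]] := (lclosP _ _).1 Ax M TM.
  have [t [Dt Mt At]] := (lclosP _ _).1 Ay M TM.
  exists (s * t); split; [exact: subringM | exact: prime_mulN (hT TM) _ _ _ _|].
  have -> : s * t * (x + y) = t * (s * x) + s * (t * y) by ring.
  by apply: (dmodD hA); exact: (dmodM hA).
- move=> a x Da Ax; apply: lclos_mul Ax _ => b Ab; apply: sub_lclos; exact: (dmodM hA).
Qed.

(** The product A(E(A) : A) is an E(A)-module, and as A is closed its closure stays inside E(A); so
    equality is decided at 1. *)
Lemma lclos_stableP A : dmod D A -> psub (lclos A) A ->
  peq (lclos (mulm A (colon (Eend A) A))) (Eend A) <->
  lclos (mulm A (colon (Eend A) A)) 1.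
Proof.
move=> hA clA; split=> [h|h1 x]; first by apply/h => b Ab; rewrite mul1r.
split=> [hx b Ab|Ex].
  apply: clA; rewrite mulrC; apply: lclos_mul hx _ => e eA; apply: sub_lclos.
  rewrite mulrC; move: Ab; move: b; change (Eend A e); move: e eA.
  apply: mulm_sub; first exact: (dmod_colon A hA).
  by move=> a c Aa Cc; rewrite mulrC; exact: Cc.
rewrite -(mulr1 x); apply: lclos_mul h1 _ => e [s [hs ->]]; apply: sub_lclos.
exists [seq (x * p.1, p.2) | p <- s]; split.
  by move=> _ /mapP[p /hs[Ap Cp] ->] /=; split=> //; exact: Ex.
by rewrite big_map mulr_sumr; apply: eq_bigr => p _; rewrite mulrA.
Qed.

(** Here [fun x => C (x / u)] is the module u C. Scaling turns a colon module such as (E(I) : I)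
    into an ideal of the ring, to which extension and contraction apply. *)
Lemma mulm_scale A C u y : dmod D A -> u != 0 ->
  mulm A C y <-> mulm A (fun x => C (x / u)) (u * y).
Proof.
move=> hA u0; split=> [[s [hs ->]]|[s [hs eqy]]].
  exists [seq (p.1, p.2 * u) | p <- s]; split.
    by move=> _ /mapP[p /hs[Ap Cp] ->] /=; rewrite mulfK.
  by rewrite big_map mulr_sumr; apply: eq_bigr => p _ /=; ring.
exists [seq (p.1, p.2 / u) | p <- s]; split; first by move=> _ /mapP[p /hs[Ap Cp] ->].
apply: (mulfI u0); rewrite eqy big_map mulr_sumr; apply: eq_bigr => p _ /=.
by field.
Qed.

Lemma lclos_scale A C u : dmod D A -> u != 0 ->
  lclos (mulm A C) 1 <-> lclos (mulm A (fun x => C (x / u))) u.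
Proof.
move=> hA u0; split=> /lclosP h; apply/lclosP => M /h[s [Ds Ms Cs]]; exists s; split=> //.
  by move/(mulm_scale _ _ hA u0): Cs; rewrite mulr1 mulrC.
by rewrite mulr1; apply/(mulm_scale _ _ hA u0); rewrite mulrC.
Qed.

Hypothesis clD : psub (lclos D) D.

Lemma lclos_ring A : psub A D -> psub (lclos A) D.
Proof. by move=> AD x Ax; apply: clD; apply: lclos_sub x Ax => a /AD; exact: sub_lclos. Qed.

Lemma lclos_idem A : peq (lclos (lclos A)) (lclos A).
Proof. by move=> x; split; [exact: lclos_sub | exact: sub_lclos]. Qed.

Lemma locally_valuation_integrally_closed :
  (forall M, T M -> valuation (loc D M)) -> integrally_closed D.
Proof.
move=> val x intx; apply: clD => M TM.
apply: valuation_integrally_closed (loc_subring (hT TM)) _ (val M TM) intx.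
exact/sub_loc/hT.
Qed.

(** * Two-generated ideals and valuation localizations of integrally closed domains *)

Lemma span2P a b x :
  span D [:: a; b] x <-> exists p q, [/\ D p, D q & x = p * a + q * b].
Proof.
split=> [[c [hc ->]]|[p [q [Dp Dq ->]]]].
  by exists (c 0%N), (c 1%N); split=> //; rewrite big_ord_recl big_ord1.
have dJ := dmod_span hD [:: a; b].
by apply: (dmodD dJ); apply: (dmodM dJ) => //; apply: mem_span => //;
  rewrite !inE eqxx ?orbT.
Qed.

(* [s t x] is an eigenvalue of the 2x2 matrix expressing multiplication by it on (a, b),
   hence a root of its characteristic polynomial. *)
Lemma integrally_closed_pair a b x : integrally_closed D -> a != 0 ->
  lclos (span D [:: a; b]) (x * a) -> lclos (span D [:: a; b]) (x * b) -> D x.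
Proof.
move=> icD a0 /lclosP ha /lclosP hb; apply/clD/lclosP => M TM.
have [s [Ds Ms /span2P[p [q [Dp Dq eqa]]]]] := ha M TM.
have [t [Dt Mt /span2P[p' [q' [Dp' Dq' eqb]]]]] := hb M TM.
exists (s * t); split; [exact: subringM | exact: prime_mulN (hT TM) _ _ _ _|].
pose tr := t * p + s * q'; pose dt := s * t * (p * q' - q * p').
have Dtr : D tr by apply: subringD => //; exact: subringM.
have Ddt : D dt by apply: subringM; [| exact: subringM | apply: subringB => //; exact: subringM].
apply: icD; exists 1%N, (fun i => if i is 0%N then dt else - tr); split.
  by case=> [|i] //; exact: subringN.
apply: (mulfI a0); rewrite mulr0 big_ord_recl big_ord1 /=.
have e1 : (s * t * x - t * p) * a = t * q * b.
  have -> : (s * t * x - t * p) * a = t * (s * (x * a)) - t * p * a by ring.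
  by rewrite eqa; ring.
have e2 : (s * t * x - s * q') * b = s * p' * a.
  have -> : (s * t * x - s * q') * b = s * (t * (x * b)) - s * q' * b by ring.
  by rewrite eqb; ring.
transitivity ((s * t * x - s * q') * ((s * t * x - t * p) * a) - s * t * q * p' * a).
  by rewrite /tr /dt /= expr0 expr1; ring.
rewrite e1; transitivity (t * q * ((s * t * x - s * q') * b) - s * t * q * p' * a).
  by ring.
by rewrite e2; ring.
Qed.

Hypothesis fracD : forall x, exists a b, [/\ D a, D b, b != 0 & x = a / b].

(** Write x = a/b. Some y in (D : (a, b)) has y a or y b outside M, and that element is a
    denominator of b/a, respectively of a/b. *)
Lemma pair_valuation M : T M ->
  (forall a b, D a -> D b -> a != 0 ->
    ~ (forall y, colon D (span D [:: a; b]) y -> M (y * a) /\ M (y * b))) ->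
  valuation (loc D M).
Proof.
move=> TM h x x0; have [a [b [Da Db b0 eqx]]] := fracD x.
have a0 : a != 0 by apply: contraNneq x0 => a0; rewrite eqx a0 mul0r.
have /existsNP[y /not_implyP[ya /not_andP Mab]] := h a b Da Db a0.
have Dya : D (y * a) by apply/ya/mem_span => //; rewrite mem_head.
have Dyb : D (y * b) by apply/ya/mem_span => //; rewrite !inE eqxx orbT.
case: Mab => [Mya|Myb]; [right|left]; apply/(locP _ (hT TM)).
  by exists (y * a); split=> //; rewrite eqx invf_div -!mulrA [a * _]mulrC divfK.
by exists (y * b); split=> //; rewrite eqx -!mulrA [b * _]mulrC divfK.
Qed.

Lemma lclos_pair_ideal a b : D a -> D b -> a != 0 ->
  [/\ ideal D (lclos (span D [:: a; b])), nonzero (lclos (span D [:: a; b])) &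
      span D [:: a; b] a /\ span D [:: a; b] b].
Proof.
move=> Da Db a0.
have ja : span D [:: a; b] a by apply: mem_span => //; rewrite mem_head.
have jb : span D [:: a; b] b by apply: mem_span => //; rewrite !inE eqxx orbT.
split=> //; last by exists a; split=> //; exact: sub_lclos.
split; first exact/dmod_lclos/dmod_span.
apply: lclos_ring; apply: span_sub => //; first exact: dmod_self.
by move=> x; rewrite !inE => /orP[] /eqP ->.
Qed.

Lemma pair_colon_prime M a b : prime_ideal D M ->
  (forall y, colon D (span D [:: a; b]) y -> M (y * a) /\ M (y * b)) ->
  forall j y, span D [:: a; b] j -> colon D (span D [:: a; b]) y -> M (j * y).
Proof.
move=> pM h j y /span2P[p [q [Dp Dq ->]]] /h[Ma Mb]; have [[[dM _] _] _] := pM.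
have -> : (p * a + q * b) * y = p * (y * a) + q * (y * b) by ring.
by apply: (dmodD dM); exact: (dmodM dM).
Qed.

Lemma divisorial_valuation : integrally_closed D ->
  (forall I, ideal D I -> nonzero I -> peq (lclos I) I -> peq (vcl D I) I) ->
  forall M, T M -> valuation (loc D M).
Proof.
move=> icD divD M TM; apply: pair_valuation => // a b Da Db a0 hM; have pM := hT TM.
set J := span D [:: a; b] in hM.
have [idI nzI [Ja Jb]] := lclos_pair_ideal Da Db a0; rewrite -/J in idI nzI Ja Jb.
have vI := divD _ idI nzI (lclos_idem _).
pose A := mulm J (colon D J).
have dA : dmod D A by apply: dmod_mulm; exact: dmod_span.
have JD : psub J D by move=> x Jx; apply: (idI.2 x); exact: sub_lclos.
have CD1 : colon D J 1 by move=> x /JD; rewrite mul1r.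
have AD : psub A D.
  by apply: mulm_sub; [exact: dmod_self | move=> x y Jx Cy; rewrite mulrC; exact: Cy].
have idA : ideal D (lclos A) by split; [exact: dmod_lclos | exact: lclos_ring].
have nzA : nonzero (lclos A).
  by exists a; split=> //; apply: sub_lclos; rewrite -(mulr1 a); exact: mulm_mem.
have vA := divD _ idA nzA (lclos_idem _).
(* The closure of A is divisorial, so it suffices that each x in (D : A) which multiplies this
   closure into D lies in D. From x J (D : J) inside D one gets x J inside J_v, hence inside I_v = I
   for I the closure of J, and [integrally_closed_pair] applies. *)
have : lclos A 1.
  apply/vA => x Cx; rewrite mul1r.
  suff key c : J c -> lclos J (x * c) by apply: integrally_closed_pair (key _ Ja) (key _ Jb).
  move=> Jc; apply/vI; suff : vcl D J (x * c).
    by apply: vcl_sub => z Jz; apply: sub_vcl; exact: sub_lclos.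
  move=> y Cy; rewrite -mulrA; apply: Cx; apply: sub_lclos; exact: mulm_mem.
move=> /lclosP/(_ M TM)[s [Ds Ms]]; rewrite mulr1 => As; apply: Ms.
have [[[dM _] _] _] := pM.
by apply: (mulm_sub dM _ As) => j y; exact: (pair_colon_prime pM hM).
Qed.

Lemma stable_valuation : integrally_closed D ->
  (forall I, ideal D I -> nonzero I -> peq (lclos I) I ->
     peq (lclos (mulm I (colon (Eend I) I))) (Eend I)) ->
  forall M, T M -> valuation (loc D M).
Proof.
move=> icD stD M TM; apply: pair_valuation => // a b Da Db a0 hM; have pM := hT TM.
set J := span D [:: a; b] in hM.
have [idI nzI [Ja Jb]] := lclos_pair_ideal Da Db a0; rewrite -/J in idI nzI Ja Jb.
(* Integral closedness makes the endomorphism ring of the closure of J as small as possible, so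
   stability becomes invertibility of J up to closure. *)
have ED : psub (Eend (lclos J)) D.
  move=> x Ex; apply: integrally_closed_pair icD a0 (Ex _ _) (Ex _ _);
  exact: sub_lclos.
have : lclos (mulm (lclos J) (colon (Eend (lclos J)) (lclos J))) 1.
  by apply/(stD _ idI nzI (lclos_idem _)) => c; rewrite mul1r.
move=> /lclosP/(_ M TM)[s [Ds Ms]]; rewrite mulr1 => As; apply: Ms.
have [[[dM _] _] primeM] := pM; apply: (mulm_sub dM _ As) => i y Ii Cy.
have Diy : D (i * y) by rewrite mulrC; apply/ED/Cy.
have [t [Dt Mt Jti]] := (lclosP _ _).1 Ii M TM.
(* The assumption on M concerns J and not its closure; the factor t outside M moves i into J, and
   primality of M removes t again. *)
have Mtiy : M (t * (i * y)).
  rewrite mulrA; apply: (pair_colon_prime pM hM Jti) => j Jj; apply/ED/Cy.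
  exact: sub_lclos.
by have [] := primeM _ _ Dt Diy Mtiy.
Qed.

End Family.
End Localization.

(** * The w-operation *)

Section WClosure.
Variables (F : fieldType) (D : F -> Prop).
Hypothesis hD : subring_pred D.
Hypothesis nonfield : exists x, [/\ D x, x != 0 & ~ D x^-1].

(** The ideal here is x D. For a nonzero nonunit x it is proper, and this is the source of t-maximal
    ideals when D is not a field. *)
Lemma t_ideal_principal x : D x -> x != 0 -> t_ideal D (fun y => D (y / x)).
Proof.
move=> Dx x0; have nzI : nonzero (fun y => D (y / x)).
  by exists x; rewrite divff //; split=> //; exact: subring1.
split; last split=> // y; first split.
- split=> [|y z|a y Da]; first by rewrite mul0r; exact: subring0.
    by rewrite mulrDl; exact: subringD.
  by rewrite -mulrA; exact: subringM.
- by move=> y Dyx; rewrite -(divfK x0 y); exact: subringM.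
- split=> [[s [sI [_]]]|]; last exact: sub_tcl.
  apply; apply: span_sub; last by move=> z /sI; rewrite mulrC.
  split=> [|y' z|a y' Da]; first by rewrite mulr0; exact: subring0.
    by rewrite mulrDr; exact: subringD.
  by rewrite mulrCA; exact: subringM.
Qed.

Lemma t_maximal_exists : exists M, t_maximal D M.
Proof.
have [x [Dx x0 Dxi]] := nonfield.
have [|M [tM _]] := exists_t_maximal hD (t_ideal_principal Dx x0); last by exists M.
by rewrite mul1r.
Qed.

Let hT M := @t_maximal_prime F D hD M.

Lemma wclP A x :
  wcl D A x <-> forall M, t_maximal D M -> exists s, [/\ D s, ~ M s & A (s * x)].
Proof. exact: (lclosP hT). Qed.

Lemma sub_wcl A : psub A (wcl D A).
Proof. by apply: sub_lclos. Qed.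

(** The c in D with c x in A form a set C contained in no t-maximal ideal. Hence 1 lies in C_t, and
    x C inside A gives x = x 1 in A_t. *)
Lemma wcl_sub_tcl A : dmod D A -> nonzero A -> psub (wcl D A) (tcl D A).
Proof.
move=> dA A0 x wx; pose C c := D c /\ A (c * x).
have hC M : t_maximal D M -> exists2 s, C s & ~ M s.
  by move=> tM; have [s [Ds Ms As]] := (wclP _ _).1 wx M tM; exists s.
have C0 : nonzero C.
  have [M tM] := t_maximal_exists; have [s Cs Ms] := hC M tM.
  by exists s; split=> //; exact: notin_neq0 (hT tM) Ms.
have CD : psub C D by move=> c [].
have tC1 : tcl D C 1.
  apply: contrapT => h; have [M [tM CM]] := exists_t_maximal hD (t_ideal_tcl hD CD C0) h.
  by have [s Cs] := hC M tM; apply; apply/CM/sub_tcl.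
rewrite -(mulr1 x); apply: (tcl_mul hD A0 tC1) => c [_ Acx].
by rewrite mulrC; exact: sub_tcl.
Qed.

Lemma wcl_ring : psub (wcl D D) D.
Proof.
move=> x wx; apply: (@tcl_sub_ring F D hD D) => //; apply: wcl_sub_tcl wx.
  exact: dmod_self.
by have [y [Dy y0 _]] := nonfield; exists y.
Qed.

Lemma wcl_sub_ring A : psub A D -> psub (wcl D A) D.
Proof. by apply: (lclos_ring hD hT) => x; exact: wcl_ring. Qed.

(** Near M the finite set s generates the ideal of one element a, so u/a lies in (D : s) for some u
    outside M. Then x in the v-closure of s gives x u/a in D, hence u x in a D, inside A. *)
Lemma tcl_sub_wcl A : PvMD D -> dmod D A -> psub (tcl D A) (wcl D A).
Proof.
move=> pv dA x [s [sA [s0 vx]]]; apply/wclP => M tM; have pM := hT tM.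
have [a [u [sa a0 Du Mu ha]]] := valuation_divisor hD pM (pv M tM) s0.
exists u; split=> //; have : D (x * (u / a)).
  apply: vx; suff : psub (span D s) (fun b => D (u / a * b)) by [].
  apply: span_sub => [|b sb]; last by rewrite mulrAC; exact: ha.
  split=> [|y z|c y Dc]; first by rewrite mulr0; exact: subring0.
    by rewrite mulrDr; exact: subringD.
  by rewrite mulrCA; exact: subringM.
move=> Dxua; rewrite (_ : u * x = x * (u / a) * a); last by field.
by apply: (dmodM dA) => //; exact: sA.
Qed.

Lemma tcl_wcl A : PvMD D -> dmod D A -> nonzero A -> tcl D A = wcl D A.
Proof.
move=> pv dA A0; apply: psub_antisym; [exact: tcl_sub_wcl | exact: wcl_sub_tcl].
Qed.

Lemma t_ideal_w_ideal A : t_ideal D A -> w_ideal D A.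
Proof.
move=> [idA [A0 tA]]; split=> //; split=> // x; split; last exact: sub_wcl.
by move=> wx; apply/tA/wcl_sub_tcl => //; case: idA.
Qed.

Lemma w_ideal_t_ideal A : PvMD D -> w_ideal D A -> t_ideal D A.
Proof. by move=> pv [[dA AD] [A0 wA]]; split=> //; split=> //; rewrite tcl_wcl. Qed.

Lemma w_ideal_wcl A : w_ideal D A -> wcl D A = A.
Proof. by move=> [_ [_ /peq_eq]]. Qed.

Lemma t_prime_sub_t_maximal P : t_prime D P -> exists M, t_maximal D M /\ psub P M.
Proof. by move=> [[[_ P1] _] tP]; exact: exists_t_maximal. Qed.

Lemma PvMD_integrally_closed : PvMD D -> integrally_closed D.
Proof.
move=> pv; apply: (locally_valuation_integrally_closed hD hT) => // x.
exact: wcl_ring.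
Qed.

End WClosure.

(** * Fractions *)

Lemma fraction_split (R : idomainType) (x : {fraction R}) :
  exists a b : R, b != 0 /\ x = tofrac a / tofrac b.
Proof.
elim/quotW: x => r; have r0 := denom_ratioP r.
exists (frac r).1, (frac r).2; split=> //.
apply: (mulIf (_ : tofrac (frac r).2 != 0)); first by rewrite tofrac_eq0.
rewrite divfK ?tofrac_eq0 //; unlock FracField.tofrac; rewrite -[LHS]FracField.pi_mul.
apply/eqmodP; rewrite /= FracField.equivfE /FracField.mulf !numden_Ratio ?mulf_neq0 ?oner_neq0 //.
by rewrite ?mulr1 ?mul1r mulrC.
Qed.

Lemma div_cancel (F : fieldType) (f g h k y : F) : f != 0 -> g != 0 ->
  f / g * y = h / k -> y = h * g / (k * f).
Proof. by move=> f0 g0 e; rewrite -mulf_div -e; field; rewrite f0 g0. Qed.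

Lemma mul_div_cancel (F : fieldType) (x h b g : F) : b != 0 ->
  x * (h * b * g) / b = h * x * g.
Proof. by move=> b0; field. Qed.

(** * Extension to and contraction from R<X> *)

Section Nagata.
Variable R : idomainType.
Hypothesis hR : exists x : R, x != 0 /\ x \notin GRing.unit.

Local Notation K := {fraction R}.
Local Notation L := {fraction {poly R}}.
Local Notation D := (@Rdom R).
Local Notation S := (@RangleX R).
Local Notation TM := (t_maximal D).

Definition cst (a : R) : L := tofrac a%:P.

Lemma cst0 : cst 0 = 0. Proof. by rewrite /cst polyC0 rmorph0. Qed.
Lemma cst1 : cst 1 = 1. Proof. by rewrite /cst polyC1 rmorph1. Qed.
Lemma cstM a b : cst (a * b) = cst a * cst b. Proof. by rewrite /cst polyCM rmorphM. Qed.
Lemma cst_eq0 a : (cst a == 0) = (a == 0).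
Proof. by rewrite /cst tofrac_eq0 polyC_eq0. Qed.

Lemma Rdom_tofrac (a : R) : D (tofrac a). Proof. by exists a. Qed.

Lemma Rdom_subring : subring_pred D.
Proof.
split; first by exists 1; rewrite rmorph1.
- by move=> _ _ [a ->] [b ->]; exists (a - b); rewrite rmorphB.
- by move=> _ _ [a ->] [b ->]; exists (a * b); rewrite rmorphM.
Qed.
Let hD := Rdom_subring.

Lemma Rdom_nonfield : exists x, [/\ D x, x != 0 & ~ D x^-1].
Proof.
have [x [x0 xU]] := hR; exists (tofrac x); split; first exact: Rdom_tofrac.
  by rewrite tofrac_eq0.
move=> [y xy]; apply/negP: xU; rewrite negbK; apply/unitrPr; exists y.
apply/eqP; rewrite -tofrac_eq rmorphM rmorph1 /= -xy divff // tofrac_eq0 //.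
Qed.
Let hN := Rdom_nonfield.

Lemma Rdom_frac (x : K) : exists a b, [/\ D a, D b, b != 0 & x = a / b].
Proof.
have [a [b [b0 ->]]] := fraction_split x; exists (tofrac a), (tofrac b).
by rewrite tofrac_eq0; split=> //; exact: Rdom_tofrac.
Qed.

Let hT M := @t_maximal_prime _ D hD M.

(** * Polynomials with coefficients in a given submodule *)

Definition polyin (A : K -> Prop) (f : {poly R}) := forall i, A (tofrac f`_i).

Lemma polyinC A c : A 0 -> polyin A c%:P <-> A (tofrac c).
Proof.
move=> A0; split=> [/(_ 0%N)|Ac i]; first by rewrite coefC.
by rewrite coefC; case: eqP => // _; rewrite rmorph0.
Qed.

Lemma polyinD A f g : dmod D A -> polyin A f -> polyin A g -> polyin A (f + g).
Proof. by move=> dA Af Ag i; rewrite coefD rmorphD; apply: (dmodD dA); [exact: Af | exact: Ag]. Qed.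

Lemma polyinMr A f g : dmod D A -> polyin A f -> polyin A (f * g).
Proof.
move=> dA Af i; rewrite coefM rmorph_sum; apply: (dmod_sum dA) => j _.
by rewrite mulrC rmorphM /=; apply: (dmodM dA); [exact: Rdom_tofrac | exact: Af].
Qed.

Lemma polyinMl A f g : dmod D A -> polyin A g -> polyin A (f * g).
Proof. by rewrite mulrC; exact: polyinMr. Qed.

(** Let i and j be the least indices of coefficients outside P. In the coefficient of f g at i + j
    every term except f_i g_j lies in P. *)
Lemma polyin_prime P f g : prime_ideal D P -> ~ polyin P f -> ~ polyin P g ->
  ~ polyin P (f * g).
Proof.
move=> pP; have [[[dP _] _] prP] := pP.
have first_notin h : ~ polyin P h ->
    exists i, ~ P (tofrac h`_i) /\ forall j, (j < i)%N -> P (tofrac h`_j).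
  move=> /existsNP[i0 hi0].
  have ex : exists i, ~~ `[< P (tofrac h`_i) >] by exists i0; apply/asboolPn.
  case: (ex_minnP ex) => i /asboolPn hi imin; exists i; split=> // j ji.
  by apply/asboolP; apply: contraTT ji => /imin; rewrite -leqNgt.
move=> /first_notin[i [fi fmin]] /first_notin[j [gj gmin]] /(_ (i + j)%N).
have ij : (i < (i + j).+1)%N by rewrite ltnS leq_addr.
rewrite coefM (bigD1 (Ordinal ij)) //= addKn => Pfg.
have [] // := prP (tofrac f`_i) (tofrac g`_j) (Rdom_tofrac _) (Rdom_tofrac _).
rewrite -rmorphM -[_ * _](addrK (\sum_(k < (i + j).+1 | k != Ordinal ij) f`_k * g`_(i + j - k))).
rewrite rmorphB; apply: (dmodB hD dP) => //; rewrite rmorph_sum.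
apply: (dmod_sum dP) => k ki; rewrite rmorphM.
have [lt|ge] := ltnP k i; first by rewrite mulrC; apply: (dmodM dP); [exact: Rdom_tofrac | exact: fmin].
apply: (dmodM dP); first exact: Rdom_tofrac.
apply: gmin; have ltik : (i < k)%N.
  by rewrite ltn_neqAle ge andbT; apply: contraNneq ki => e; apply/eqP/val_inj.
by rewrite ltn_subLR ?ltn_add2r // -ltnS.
Qed.

Lemma poly_coef_notin (P : K -> Prop) f : ~ polyin P f -> exists i, ~ P (tofrac f`_i).
Proof. by move=> /existsNP. Qed.

Lemma polyin_neq0 P f : P 0 -> ~ polyin P f -> f != 0.
Proof. by move=> P0 Pf; apply/eqP => f0; apply: Pf => i; rewrite f0 coef0 rmorph0. Qed.

Lemma poly_neq0_coef (f : {poly R}) : f != 0 -> exists i, f`_i != 0.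
Proof. by move=> f0; exists (size f).-1; rewrite -lead_coefE lead_coef_eq0. Qed.

(** * The set N_t, the ring R<X>, and extension of ideals to it *)

Lemma content_coef (f : {poly R}) i : content f (tofrac f`_i).
Proof.
have [ge|lt] := leqP (size f) i.
  exists (fun=> 0); rewrite nth_default // big1 // => j _; exact: mul0r.
exists (fun j => (j == i)%:R); rewrite (bigD1 (Ordinal lt)) //= eqxx mul1r big1 ?addr0 // => j ji.
by rewrite (_ : _ == _ = false) ?mul0r //; apply/negbTE.
Qed.

Lemma content_sub (f : {poly R}) A : dmod D A -> polyin A f -> psub (content f) A.
Proof.
move=> dA Af _ [c ->]; rewrite rmorph_sum; apply: (dmod_sum dA) => i _.
by rewrite rmorphM; apply: (dmodM dA); [exact: Rdom_tofrac | exact: Af].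
Qed.

(** A proper t-closure of the content lies in a t-maximal ideal, which then contains all
    coefficients of g. *)
Lemma NtP (g : {poly R}) : Nt g <-> forall M, TM M -> ~ polyin M g.
Proof.
split=> [Ng M tM Mg|h].
  have [[[dM _] [M0 tclM]] M1 _] := tM; apply/M1/tclM.
  apply: (tcl_sub hD M0 _ (x := 1)); last by apply/Ng; exact: subring1 hD.
  by move=> x /(content_sub dM Mg); exact: sub_tcl.
have cD : psub (content g) D by move=> x [c ->]; exact: Rdom_tofrac.
(* Since R is not a field there is a t-maximal ideal, and a coefficient of g outside it is
   nonzero. *)
have c0 : nonzero (content g).
  have [M tM] := t_maximal_exists hD hN; have [i Mi] := poly_coef_notin (h M tM).
  exists (tofrac g`_i); split; first exact: content_coef.
  exact: notin_neq0 (hT tM) Mi.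
have tc := t_ideal_tcl hD cD c0; have [[dtc tcD] _] := tc.
have [t1|t1] := EM (tcl D (content g) 1).
  move=> x; split=> [/tcD //|Dx]; rewrite -(mulr1 x); exact: (dmodM dtc).
have [M [tM cM]] := exists_t_maximal hD tc t1.
by case: (h M tM) => i; apply/cM/sub_tcl => //; exact: content_coef.
Qed.

Lemma Nt_notin (g : {poly R}) M : Nt g -> TM M -> ~ polyin M g.
Proof. by move=> /NtP; exact. Qed.

Lemma Nt_neq0 (g : {poly R}) : Nt g -> g != 0.
Proof.
move=> Ng; have [M tM] := t_maximal_exists hD hN.
exact: polyin_neq0 (prime0 (hT tM)) (Nt_notin Ng tM).
Qed.

Lemma Nt1 : @Nt R 1.
Proof.
apply/NtP => M tM; have [[_ M1] _] := hT tM.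
by move=> /(_ 0%N); rewrite coef1 rmorph1.
Qed.

Lemma NtM (f g : {poly R}) : Nt f -> Nt g -> Nt (f * g).
Proof.
move=> Nf Ng; apply/NtP => M tM.
by apply: polyin_prime (hT tM) _ _; exact: Nt_notin.
Qed.

Lemma tofrac_neq0 (f : {poly R}) : f != 0 -> tofrac f != 0 :> L.
Proof. by rewrite tofrac_eq0. Qed.

Lemma frac_eqP (f g h k : {poly R}) : g != 0 -> k != 0 ->
  tofrac f / tofrac g = tofrac h / tofrac k :> L -> f * k = h * g.
Proof.
move=> g0 k0 /eqP; rewrite eqr_div ?tofrac_neq0 // -!rmorphM tofrac_eq => /eqP.
by rewrite [h * g]mulrC => ->; rewrite mulrC.
Qed.

Lemma RangleX_tofrac f : S (tofrac f).
Proof. by exists f, 1; split; [exact: Nt1 | rewrite rmorph1 divr1]. Qed.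

Lemma RangleX_subring : subring_pred S.
Proof.
split; first by rewrite -(rmorph1 tofrac); exact: RangleX_tofrac.
- move=> _ _ [f [g [Ng ->]]] [h [k [Nk ->]]].
  exists (f * k + - h * g), (g * k); split; first exact: NtM.
  by rewrite -mulNr addf_div ?tofrac_neq0 ?Nt_neq0 // -rmorphN -!rmorphM -rmorphD.
- move=> _ _ [f [g [Ng ->]]] [h [k [Nk ->]]].
  by exists (f * h), (g * k); split; [exact: NtM | rewrite !rmorphM mulf_div].
Qed.
Let hS := RangleX_subring.

Lemma RangleX_frac (x : L) : exists a b, [/\ S a, S b, b != 0 & x = a / b].
Proof.
have [a [b [b0 ->]]] := fraction_split x; exists (tofrac a), (tofrac b).
by rewrite tofrac_eq0; split=> //; exact: RangleX_tofrac.
Qed.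

(** For an ideal A of R this is AR<X>, every element being put over one denominator. The
    coefficients come from R, so in general only the intersection of A with R enters. *)
Definition ext (A : K -> Prop) : L -> Prop :=
  fun y => exists f g, [/\ Nt g, polyin A f & y = tofrac f / tofrac g].
Definition con (J : L -> Prop) : K -> Prop :=
  fun x => exists a, x = tofrac a /\ J (cst a).

Lemma ext_frac A f g : Nt g -> polyin A f -> ext A (tofrac f / tofrac g).
Proof. by move=> Ng Af; exists f, g. Qed.

Lemma ext_poly A f : polyin A f -> ext A (tofrac f).
Proof. by move=> Af; exists f, 1; rewrite rmorph1 divr1; split=> //; exact: Nt1. Qed.

Lemma ext_cst A a : A 0 -> A (tofrac a) -> ext A (cst a).
Proof. by move=> A0 Aa; apply/ext_poly/polyinC. Qed.

Lemma ext_mono A B : psub A B -> psub (ext A) (ext B).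
Proof. by move=> AB _ [f [g [Ng Af ->]]]; apply: ext_frac => // i; exact: AB. Qed.

Lemma ext_sub_ring A : psub (ext A) S.
Proof. by move=> _ [f [g [Ng _ ->]]]; exists f, g. Qed.

Lemma ext_Rdom : ext D = S.
Proof.
apply: psub_antisym; first exact: ext_sub_ring.
by move=> _ [f [g [Ng ->]]]; apply: ext_frac => // i; exact: Rdom_tofrac.
Qed.

Lemma dmod_ext A : dmod D A -> dmod S (ext A).
Proof.
move=> dA; split.
- by rewrite -cst0; apply: ext_cst; rewrite ?rmorph0; exact: (dmod0 dA).
- move=> _ _ [f [g [Ng Af ->]]] [h [k [Nk Ah ->]]].
  exists (f * k + h * g), (g * k); split; first exact: NtM.
    by apply: polyinD => //; exact: polyinMr.
  by rewrite addf_div ?tofrac_neq0 ?Nt_neq0 // -!rmorphM -rmorphD.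
- move=> _ _ [h [k [Nk ->]]] [f [g [Ng Af ->]]].
  exists (h * f), (k * g); split; [exact: NtM | exact: polyinMl |].
  by rewrite !rmorphM mulf_div.
Qed.

Lemma ideal_ext A : dmod D A -> ideal S (ext A).
Proof. by move=> dA; split; [exact: dmod_ext | exact: ext_sub_ring]. Qed.

Lemma con_cst J a : con J (tofrac a) <-> J (cst a).
Proof.
by split=> [[b [/eqP + Jb]]|Ja]; [rewrite tofrac_eq => /eqP -> | exists a].
Qed.

Lemma con_sub_ring J : psub (con J) D.
Proof. by move=> _ [a [-> _]]; exact: Rdom_tofrac. Qed.

Lemma ideal_con J : dmod S J -> ideal D (con J).
Proof.
move=> dJ; split; last exact: con_sub_ring; split.
- by rewrite -(rmorph0 tofrac); apply/con_cst; rewrite cst0; exact: (dmod0 dJ).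
- move=> _ _ [a [-> Ja]] [b [-> Jb]]; rewrite -rmorphD; apply/con_cst.
  by rewrite /cst polyCD rmorphD; exact: (dmodD dJ).
- move=> _ _ [a ->] [b [-> Jb]]; rewrite -rmorphM; apply/con_cst.
  by rewrite cstM; apply: (dmodM dJ) => //; exact: RangleX_tofrac.
Qed.

Lemma con_mono I J : psub I J -> psub (con I) (con J).
Proof. by move=> IJ _ [a [-> Ia]]; apply/con_cst/IJ. Qed.

(** If f/g = h/k with h in P[X] and k in N_t, then f k = h g lies in the prime P[X] while k does
    not. Membership in PR<X> is thus read off any numerator. *)
Lemma ext_prime_polyin P f g : prime_ideal D P -> g != 0 -> ~ polyin P g ->
  (forall k, Nt k -> ~ polyin P k) ->
  ext P (tofrac f / tofrac g) -> polyin P f.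
Proof.
move=> pP g0 Pg NP [h [k [Nk Ph]]] /(frac_eqP g0 (Nt_neq0 Nk)) e.
have [[[dP _] _] _] := pP.
apply: contrapT => Pf; have := polyin_prime pP Pf (NP k Nk); apply.
by rewrite e; exact: polyinMr.
Qed.

(** The t-maximal ideal M above P keeps N_t disjoint from P[X], so the prime P[X] survives in
    R<X>. *)
Lemma ext_prime P M : prime_ideal D P -> TM M -> psub P M -> prime_ideal S (ext P).
Proof.
move=> pP tM PM; have [[[dP _] P1] prP] := pP.
have NP k : Nt k -> ~ polyin P k.
  by move=> Nk Pk; apply: (Nt_notin Nk tM) => i; exact: PM.
have memP f g : Nt g -> ext P (tofrac f / tofrac g) -> polyin P f.
  by move=> Ng; apply: ext_prime_polyin => //; [exact: Nt_neq0 | exact: NP].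
split.
  split; first exact: ideal_ext.
  rewrite -cst1 -(divr1 (cst 1)) -(rmorph1 tofrac) => /(memP _ _ Nt1) /polyinC.
  by rewrite rmorph1 => h; apply/P1/h; exact: (dmod0 dP).
move=> _ _ [f [g [Ng ->]]] [h [k [Nk ->]]].
rewrite mulf_div -!rmorphM => /(memP _ _ (NtM Ng Nk)) Pfh.
apply: contrapT => /not_orP[Pf Ph].
by apply: (polyin_prime pP _ _ Pfh) => ?; [apply: Pf | apply: Ph]; exact: ext_frac.
Qed.

Lemma ext_t_maximal_prime M : TM M -> prime_ideal S (ext M).
Proof. by move=> tM; apply: (@ext_prime M M) => //; exact: hT. Qed.

Lemma ext_t_maximal_polyin M f g : TM M -> Nt g ->
  ext M (tofrac f / tofrac g) <-> polyin M f.
Proof.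
move=> tM Ng; split; last exact: ext_frac.
apply: ext_prime_polyin (hT tM) (Nt_neq0 Ng) (Nt_notin Ng tM) _ => k Nk.
exact: Nt_notin.
Qed.

Lemma ext_t_maximal_tofrac M f : TM M -> ext M (tofrac f) <-> polyin M f.
Proof.
by move=> tM; rewrite -(ext_t_maximal_polyin _ tM Nt1) rmorph1 divr1.
Qed.

Lemma ext_t_maximal_cst M a : TM M -> ext M (cst a) <-> M (tofrac a).
Proof.
move=> tM; rewrite ext_t_maximal_tofrac // polyinC //; exact: prime0 (hT tM).
Qed.

Lemma con_ext_t_maximal M : TM M -> con (ext M) = M.
Proof.
move=> tM; apply: psub_antisym => [_ [a [-> /(ext_t_maximal_cst _ tM)]] //|x Mx].
have [[[_ MD] _] _] := hT tM; have [a eqx] := MD _ Mx; rewrite eqx in Mx *.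
exact/con_cst/ext_t_maximal_cst.
Qed.

Lemma ext_psub M N : TM M -> TM N -> psub (ext M) (ext N) -> psub M N.
Proof. by move=> tM tN /con_mono; rewrite !con_ext_t_maximal. Qed.

(* [f1 + X^n f2] with [n >= size f1] carries the coefficients of both polynomials. *)
Lemma gather_coefs (J : L -> Prop) (s : seq K) : dmod S J ->
  (forall x, x \in s -> exists f i, J (tofrac f) /\ x = tofrac f`_i) ->
  exists f, J (tofrac f) /\
    forall A, A 0 -> polyin A f -> forall x, x \in s -> A x.
Proof.
move=> dJ; elim: s => [_|x s IH h].
  by exists 0; rewrite rmorph0; split; first exact: (dmod0 dJ).
have [|f [Jf hf]] := IH; first by move=> y ys; apply: h; rewrite inE ys orbT.
have [f1 [i [Jf1 xE]]] := h x (mem_head _ _).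
exists (f + f1 * 'X^(size f)); split.
  rewrite rmorphD rmorphM; apply: (dmodD dJ) => //.
  by rewrite mulrC; apply: (dmodM dJ) => //; exact: RangleX_tofrac.
move=> A A0 Af y; rewrite inE => /orP[/eqP ->|ys].
  have := Af (i + size f)%N; rewrite coefD coefMXn ltnNge leq_addl /= addnK.
  by rewrite [f`_ _]nth_default ?leq_addl // add0r xE.
apply: hf ys => // j; have [ge|lt] := leqP (size f) j; first by rewrite nth_default // rmorph0.
by have := Af j; rewrite coefD coefMXn lt addr0.
Qed.

(** * Maximal ideals of R<X> and finite character *)

Lemma ideal_not_in_ext J : ideal S J -> (forall M, TM M -> ~ psub J (ext M)) -> J 1.
Proof.
move=> [dJ JS] nJ.
pose C x := exists f i, J (tofrac f) /\ x = tofrac f`_i.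
have CD : psub C D by move=> _ [f [i [_ ->]]]; exact: Rdom_tofrac.
have inJ f g : Nt g -> J (tofrac f / tofrac g) -> J (tofrac f).
  move=> Ng Jfg; rewrite -(divfK (tofrac_neq0 (Nt_neq0 Ng)) (tofrac f)) mulrC.
  by apply: (dmodM dJ) => //; exact: RangleX_tofrac.
have C0 : nonzero C.
  have [M tM] := t_maximal_exists hD hN.
  have /existsNP[y /not_implyP[Jy My]] := nJ M tM.
  have [f [g [Ng yE]]] := JS y Jy; rewrite yE in Jy My.
  have [i Mi] : exists i, ~ M (tofrac f`_i).
    by apply/existsNP => Mf; apply: My; exact: ext_frac.
  exists (tofrac f`_i); split; first by exists f, i; split=> //; exact: inJ Jy.
  exact: notin_neq0 (hT tM) Mi.
have tC := t_ideal_tcl hD CD C0.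
have [[s [sC [_ s1]]]|t1] := EM (tcl D C 1); last first.
  have [M [tM CM]] := exists_t_maximal hD tC t1.
  case: (nJ M tM) => y Jy; have [f [g [Ng yE]]] := JS y Jy; rewrite yE in Jy *.
  apply: ext_frac => // i; apply/CM/sub_tcl => //.
  by exists f, i; split=> //; exact: inJ Jy.
(* The finitely many coefficients in s have 1 in their v-closure and all occur in one f of J. If f
   were in M[X], all of s would lie in the t-ideal M, forcing 1 into M. *)
have [f [Jf hf]] := gather_coefs dJ sC.
have Nf : Nt f.
  apply/NtP => M tM Mf; have [tiM M1 _] := tM.
  by apply: (t_ideal_not1 hD tiM M1 _ s1) => x; apply: hf => //; exact: prime0 (hT tM).
rewrite -(mulVf (tofrac_neq0 (Nt_neq0 Nf))); apply: (dmodM dJ) => //.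
by exists 1, f; rewrite rmorph1 div1r.
Qed.

Lemma proper_sub_ext J : proper_ideal S J -> exists M, TM M /\ psub J (ext M).
Proof.
move=> [idJ J1]; apply: contrapT => h; apply: J1; apply: ideal_not_in_ext => // M tM JM.
by apply: h; exists M.
Qed.

Lemma maximal_ext M : TM M -> maximal_ideal S (ext M).
Proof.
move=> tM; have [pM _] := ext_t_maximal_prime tM; split=> // J pJ MJ.
have [N [tN JN]] := proper_sub_ext pJ.
have MN : psub M N by apply: ext_psub => //; exact: psub_trans MJ JN.
have [tiM _ maxM] := tM; have [tiN N1 _] := tN.
apply: psub_trans JN _; apply: ext_mono; exact: maxM.
Qed.

Lemma maximalP Q : maximal_ideal S Q <-> exists2 M, TM M & Q = ext M.
Proof.
split=> [[pQ maxQ]|[M tM ->]]; last exact: maximal_ext.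
have [M [tM QM]] := proper_sub_ext pQ; exists M => //; apply: psub_antisym => //.
by apply: maxQ => //; have [] := ext_t_maximal_prime tM.
Qed.

Lemma maximal_prime Q : maximal_ideal S Q -> prime_ideal S Q.
Proof. by move=> /maximalP[M tM ->]; exact: ext_t_maximal_prime. Qed.

(** If f/g lies in MR<X>, a chosen nonzero coefficient of f lies in M, and only finitely many M
    allow that. Conversely an element of R is tested as a constant polynomial. *)
Lemma finite_character_iff : t_finite_character D <-> finite_character S.
Proof.
split=> fc x.
  move=> [f [g [Ng ->]]] /eqP x0; have f0 : f != 0.
    by apply/eqP => f0; apply: x0; rewrite f0 rmorph0 mul0r.
  have [i fi] := poly_neq0_coef f0.
  have [|s hs] := fc _ (Rdom_tofrac f`_i); first by rewrite tofrac_eq0.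
  exists (map ext s) => Q [/maximalP[M tM ->]] /(ext_t_maximal_polyin _ tM Ng) Mf.
  have [|j js /peq_eq MJ] := hs M; first by split=> //; exact: Mf.
  by exists j; rewrite ?size_map // (nth_map (fun=> False)) // -MJ.
move=> [a ->]; rewrite tofrac_eq0 => a0.
have [|s hs] := fc _ (RangleX_tofrac a%:P); first by rewrite tofrac_eq0 polyC_eq0.
exists (map con s) => M [tM Ma].
have [|j js /peq_eq MJ] := hs (ext M).
  by split; [exact: maximal_ext | exact/ext_t_maximal_cst].
exists j; rewrite ?size_map // (nth_map (fun=> False)) // -MJ.
by rewrite con_ext_t_maximal.
Qed.

(** The v in R<X> with v x in J form an ideal contained in no maximal ideal, so it contains 1. *)
Lemma lclos_maximal J : dmod S J -> psub (lclos S (maximal_ideal S) J) J.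
Proof.
move=> dJ x clx; pose J' v := S v /\ J (v * x).
rewrite -(mul1r x); suff [] : J' 1 by [].
apply: ideal_not_in_ext => [|M tM J'M].
  split=> [|v []//]; split.
  - by rewrite /J' mul0r; split; [exact: subring0 hS | exact: (dmod0 dJ)].
  - move=> v w [Sv Jv] [Sw Jw]; split; first exact: subringD.
    by rewrite mulrDl; exact: (dmodD dJ).
  - move=> a v Sa [Sv Jv]; split; first exact: subringM.
    by rewrite -mulrA; exact: (dmodM dJ).
have [s [Ss Ms Js]] := (lclosP maximal_prime _ _).1 clx _ (maximal_ext tM).
by apply: Ms; apply: J'M.
Qed.

(** * The localization of R<X> at MR<X>, which is R[X] at M[X], and the valuation property *)

Lemma loc_extP M y : TM M -> loc S (ext M) y <->
  exists f g, ~ polyin M g /\ y = tofrac f / tofrac g.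
Proof.
move=> tM; have pM := ext_t_maximal_prime tM; split=> [|[f [g [Mg ->]]]].
  move=> /(locP _ pM)[_ [[f [g [Ng ->]]] Mf [h [k [Nk fy]]]]].
  have {}Mf : ~ polyin M f by move=> ?; apply: Mf; exact: ext_frac.
  have f0 := polyin_neq0 (prime0 (hT tM)) Mf.
  exists (h * g), (k * f); split; first exact: polyin_prime (hT tM) (Nt_notin Nk tM) Mf.
  have g0 := Nt_neq0 Ng.
  by rewrite !rmorphM; apply: div_cancel fy; exact: tofrac_neq0.
have g0 := polyin_neq0 (prime0 (hT tM)) Mg.
apply/(locP _ pM); exists (tofrac g); split; first exact: RangleX_tofrac.
  by move=> /(ext_t_maximal_tofrac _ tM).
by rewrite mulrC divfK ?tofrac_neq0 //; exact: RangleX_tofrac.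
Qed.

Lemma poly_scale_choice (c : K) (f : {poly R}) : (forall i, D (c * tofrac f`_i)) ->
  exists f' : {poly R}, forall i, tofrac f'`_i = c * tofrac f`_i.
Proof.
move=> /choice[r hr]; exists (\poly_(i < size f) r i) => i; rewrite coef_poly.
by case: ltnP => // ge; rewrite nth_default // rmorph0 mulr0.
Qed.

(** Locally at M the content of f is generated by one coefficient f_j. Dividing f by it, up to a
    denominator u, leaves f' whose coefficient at j is u, which is outside M. *)
Lemma valuation_content M (f : {poly R}) : TM M -> valuation (loc D M) -> f != 0 ->
  exists j u f', [/\ f`_j != 0, ~ M (tofrac u), ~ polyin M f' & u *: f = f`_j *: f'].
Proof.
move=> tM val f0; pose s := [seq tofrac f`_i | i <- iota 0 (size f)].
have [|a [_ [/mapP[j _ ->] a0 [u ->] Mu hs]]] := valuation_divisor hD (hT tM) (s := s) val.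
  have [i fi] := poly_neq0_coef f0; exists (tofrac f`_i); last by rewrite tofrac_eq0.
  apply: (map_f (fun i => tofrac f`_i)); rewrite mem_iota add0n /=.
  by apply: contra_neqT fi; rewrite -leqNgt => /(nth_default 0) ->.
have [|f' hf'] := @poly_scale_choice (tofrac u / tofrac f`_j) f.
  move=> i; rewrite mulrAC; have [ge|lt] := leqP (size f) i.
    by rewrite nth_default // rmorph0 mulr0 mul0r; exact: subring0 hD.
  by apply: hs; apply: (map_f (fun i => tofrac f`_i)); rewrite mem_iota add0n.
exists j, u, f'; split=> //; first by rewrite -tofrac_eq0.
  by move=> /(_ j); rewrite hf' divfK.
apply/polyP => i; rewrite !coefZ; apply/eqP; rewrite -tofrac_eq !tofracM hf'.
by rewrite mulrA [tofrac f`_j * _]mulrC divfK.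
Qed.

Lemma loc_ext_div M (f g f' g' : {poly R}) (fi gj u v : R) : TM M ->
  fi != 0 -> gj != 0 -> g != 0 -> ~ M (tofrac u) -> ~ polyin M g' ->
  u *: f = fi *: f' -> v *: g = gj *: g' ->
  loc D M (tofrac fi / tofrac gj) -> loc S (ext M) (tofrac f / tofrac g).
Proof.
move=> tM fi0 gj0 g0 Mu Mg' fE gE; have pM := hT tM; have M0 := prime0 pM.
have cN c : ~ M (tofrac c) -> ~ polyin M c%:P by move=> Mc /(polyinC _ M0).
move=> /(locP _ pM)[_ [[w ->] Mw [r]]].
have gj0' : tofrac gj != 0 :> K by rewrite tofrac_eq0.
move=> /(congr1 (fun z => z * tofrac gj)); rewrite -mulrA divfK // -!rmorphM.
move=> /eqP; rewrite tofrac_eq => /eqP wr.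
have Mwug : ~ polyin M (w%:P * u%:P * g').
  by apply: polyin_prime => //; apply: polyin_prime => //; exact: cN.
(* With f = (fi/u) f' and g = (gj/v) g', the quotient f/g is (fi/gj) (v f')/(u g'), where fi/gj =
   r/w and w is outside M. *)
apply/(loc_extP _ tM); exists (r%:P * v%:P * f'), (w%:P * u%:P * g'); split=> //.
apply/eqP; rewrite eqr_div ?tofrac_neq0 ?(polyin_neq0 M0 Mwug) //.
rewrite -!rmorphM tofrac_eq -!mul_polyC in fE gE *; apply/eqP.
transitivity (w%:P * (u%:P * f) * g'); first by ring.
transitivity (r%:P * (v%:P * g) * f'); last by ring.
by rewrite fE gE !mulrA -!polyCM wr; ring.
Qed.

Lemma valuation_ext M : TM M -> valuation (loc D M) -> valuation (loc S (ext M)).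
Proof.
move=> tM val y y0; have [f [g [g0 yE]]] := fraction_split y.
have f0 : f != 0 by apply: contraNneq y0 => f0; rewrite yE f0 rmorph0 mul0r.
have [i [u [f' [fi Mu Mf' fE]]]] := valuation_content tM val f0.
have [j [v [g' [gj Mv Mg' gE]]]] := valuation_content tM val g0.
have [] := val (tofrac f`_i / tofrac g`_j); rewrite ?mulf_neq0 ?invr_eq0 ?tofrac_eq0 //.
  by move=> h; left; rewrite yE; exact: (loc_ext_div tM fi gj g0 Mu Mg' fE gE h).
by rewrite yE !invf_div => h; right; exact: (loc_ext_div tM gj fi f0 Mv Mf' gE fE h).
Qed.

Lemma ext_valuation M : TM M -> valuation (loc S (ext M)) -> valuation (loc D M).
Proof.
move=> tM val x x0; have [a [b [b0 xE]]] := fraction_split x; have pM := hT tM.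
have a0 : a != 0 by apply: contraNneq x0 => a0; rewrite xE a0 rmorph0 mul0r.
(* Comparing coefficients in c g = f d at an index i with g_i outside M gives g_i (c/d) = f_i in
   R. *)
have half c d : d != 0 -> loc S (ext M) (cst c / cst d) -> loc D M (tofrac c / tofrac d).
  move=> d0 /(loc_extP _ tM)[f [g [/existsNP[i Mgi]]]] e.
  have g0 : g != 0 by apply: contra_not_neq Mgi => ->; rewrite coef0 rmorph0; exact: prime0 pM.
  have {}e : c%:P * g = f * d%:P by apply: frac_eqP e; rewrite ?polyC_eq0.
  apply/(locP _ pM); exists (tofrac g`_i); split=> //; first exact: Rdom_tofrac.
  exists f`_i; rewrite mulrA -rmorphM; apply/eqP.
  rewrite -(inj_eq (mulIf (_ : tofrac d != 0))) ?tofrac_eq0 // divfK ?tofrac_eq0 //.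
  rewrite -rmorphM tofrac_eq; move/(congr1 (fun p : {poly R} => p`_i)): e.
  by rewrite coefCM coefMC mulrC => ->.
have [] := val (cst a / cst b); rewrite ?mulf_neq0 ?invr_eq0 ?cst_eq0 //.
  by move=> /half; rewrite xE; left; auto.
by rewrite invf_div => /half; rewrite xE invf_div; right; auto.
Qed.

Lemma PvMD_iff_Prufer : PvMD D <-> Prufer S.
Proof.
split=> [pv Q /maximalP[M tM ->]|pr M tM]; first exact/valuation_ext/pv.
exact/ext_valuation/pr/maximal_ext.
Qed.

(** * Ideals of R<X> over a PvMD *)

Lemma poly_of_coefs J (f : {poly R}) : dmod S J -> (forall i, J (cst f`_i)) -> J (tofrac f).
Proof.
move=> dJ Jf; rewrite -(coefK f) poly_def rmorph_sum; apply: (dmod_sum dJ) => i _.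
rewrite -mul_polyC mulrC rmorphM; apply: (dmodM dJ); last exact: Jf.
exact: RangleX_tofrac.
Qed.

(** It suffices to argue locally. From u f = f_j f' one reads u f_i = f_j f'_i, hence (u f') f_i =
    (f'_i u) f lies in J, with u f' outside M[X]. *)
Lemma coefs_of_poly J (f : {poly R}) : PvMD D -> dmod S J -> J (tofrac f) -> forall i, J (cst f`_i).
Proof.
move=> pv dJ Jf i; have [->|f0] := eqVneq f 0.
  by rewrite coef0 cst0; exact: (dmod0 dJ).
apply: lclos_maximal => //; apply/(lclosP maximal_prime) => _ /maximalP[M tM ->].
have [j [u [f' [fj Mu Mf' fE]]]] := valuation_content tM (pv M tM) f0.
exists (tofrac (u%:P * f')); split; first exact: RangleX_tofrac.
  move=> /(ext_t_maximal_tofrac _ tM); apply: polyin_prime => //; first exact: hT.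
  by move=> /(polyinC _ (prime0 (hT tM))).
have -> : tofrac (u%:P * f') * cst f`_i = tofrac ((f'`_i)%:P * u%:P) * tofrac f.
  rewrite /cst -!tofracM; congr (tofrac _).
  have /(congr1 polyC) := congr1 (fun p : {poly R} => p`_i) fE.
  rewrite !coefZ !polyCM => fEi; rewrite -!mul_polyC in fE.
  by rewrite mulrAC fEi -[RHS]mulrA fE; ring.
by apply: (dmodM dJ) => //; exact: RangleX_tofrac.
Qed.

Lemma ext_con J : PvMD D -> ideal S J -> ext (con J) = J.
Proof.
move=> pv [dJ JS]; apply: psub_antisym.
  move=> _ [f [g [Ng Jf ->]]]; rewrite mulrC; apply: (dmodM dJ).
    by exists 1, g; rewrite rmorph1 div1r.
  by apply: poly_of_coefs => // i; exact/con_cst/Jf.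
move=> y Jy; have [f [g [Ng yE]]] := JS y Jy; rewrite yE in Jy *.
apply: ext_frac => // i; apply/con_cst; apply: (coefs_of_poly pv dJ).
rewrite -(divfK (tofrac_neq0 (Nt_neq0 Ng)) (tofrac f)) mulrC.
by apply: (dmodM dJ) => //; exact: RangleX_tofrac.
Qed.

(** In a g = f b the coefficients satisfy a g_i = f_i b, and for each t-maximal M some g_i is
    outside M. Fractions a/b are allowed because products with elements of colon modules have this
    form. *)
Lemma ext_div_wcl A a b : b != 0 -> ext A (cst a / cst b) -> wcl D A (tofrac a / tofrac b).
Proof.
move=> b0 [f [g [Ng Af e]]].
have {}e : a%:P * g = f * b%:P by apply: frac_eqP e; rewrite ?polyC_eq0 ?Nt_neq0.
apply/(wclP hD) => M tM; have /existsNP[i Mgi] := Nt_notin Ng tM.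
exists (tofrac g`_i); split; [exact: Rdom_tofrac | by [] |].
rewrite mulrA -tofracM; move/(congr1 (fun p : {poly R} => p`_i)): e.
rewrite coefCM coefMC mulrC => ->; rewrite tofracM mulfK ?tofrac_eq0 //; exact: Af.
Qed.

(** A denominator of x outside M stays outside MR<X> as a constant, and submodules of R<X> are
    closed along its maximal ideals. *)
Lemma wcl_con J : dmod S J -> psub (wcl D (con J)) (con J).
Proof.
move=> dJ x wx.
have [a xE] : D x.
  by apply: (wcl_sub_ring hD hN _ wx); exact: con_sub_ring.
rewrite xE in wx *; apply/con_cst; apply: (lclos_maximal dJ).
apply/(lclosP maximal_prime) => _ /maximalP[M tM ->].
have [_ [[s ->] Ms]] := (wclP hD _ _).1 wx M tM.
rewrite -tofracM => /con_cst; rewrite cstM => Jsa; exists (cst s); split=> //.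
  exact: RangleX_tofrac.
by move=> /(ext_t_maximal_cst _ tM).
Qed.

Lemma sub_con_ext A : ideal D A -> psub A (con (ext A)).
Proof.
move=> [dA AD] x Ax; have [a xE] := AD x Ax; rewrite xE in Ax *.
by apply/con_cst/ext_cst => //; exact: (dmod0 dA).
Qed.

Lemma con_ext A : ideal D A -> con (ext A) = wcl D A.
Proof.
move=> idA; apply: psub_antisym => [_ [a [-> Aa]]|x wx].
  rewrite -(divr1 (tofrac a)) -(rmorph1 tofrac); apply: ext_div_wcl; first exact: oner_neq0.
  by rewrite cst1 divr1.
apply: wcl_con; first by apply: dmod_ext; case: idA.
apply: (lclos_sub hD hT _ wx) => y Ay; apply: (sub_lclos hD hT); exact: sub_con_ext.
Qed.

Lemma con_ext_w A : w_ideal D A -> con (ext A) = A.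
Proof. by move=> wA; rewrite con_ext ?w_ideal_wcl //; case: wA. Qed.

Lemma nonzero_ext A : ideal D A -> nonzero A -> nonzero (ext A).
Proof.
move=> [dA AD] [x [Ax x0]]; have [a xE] := AD x Ax; rewrite xE in Ax x0.
exists (cst a); rewrite cst_eq0 -(tofrac_eq0 a); split=> //.
by apply: ext_cst => //; exact: (dmod0 dA).
Qed.

Lemma nonzero_con J : PvMD D -> ideal S J -> nonzero J -> nonzero (con J).
Proof.
move=> pv idJ; rewrite -{1}(ext_con pv idJ) => -[_ [[f [g [Ng Jf ->]]] y0]].
have [i fi] : exists i, f`_i != 0.
  by apply: poly_neq0_coef; apply: contraNneq y0 => ->; rewrite rmorph0 mul0r.
by exists (tofrac f`_i); rewrite tofrac_eq0; split; first exact: Jf.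
Qed.

Lemma w_ideal_con J : PvMD D -> ideal S J -> nonzero J -> w_ideal D (con J).
Proof.
move=> pv idJ J0; have [dJ _] := idJ; split; first exact: ideal_con.
split; first exact: nonzero_con.
by move=> x; split; [exact: wcl_con | exact: sub_wcl].
Qed.

Lemma mulm_ext A B : ideal D A -> ideal D B -> mulm (ext A) (ext B) = ext (mulm A B).
Proof.
move=> [dA AD] [dB BD]; have dAB := dmod_mulm B dA; apply: psub_antisym.
  apply: mulm_sub; first exact: dmod_ext.
  move=> _ _ [f [g [Ng Af ->]]] [h [k [Nk Bh ->]]]; rewrite mulf_div -!tofracM.
  apply: ext_frac; first exact: NtM.
  move=> i; rewrite coefM rmorph_sum; apply: (dmod_sum dAB) => j _.
  by rewrite rmorphM; apply: mulm_mem; [exact: Af | exact: Bh].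
have dE : dmod S (mulm (ext A) (ext B)) by apply/dmod_mulm/dmod_ext.
have inC : psub (mulm A B) (con (mulm (ext A) (ext B))).
  apply: mulm_sub; first exact: (ideal_con dE).1.
  move=> x y Ax By; have [a xE] := AD x Ax; have [b yE] := BD y By.
  rewrite xE in Ax *; rewrite yE in By *; rewrite -tofracM; apply/con_cst.
  by rewrite cstM; apply: mulm_mem; apply: ext_cst => //; apply: dmod0; eassumption.
move=> _ [f [g [Ng ABf ->]]]; rewrite mulrC; apply: (dmodM dE).
  by exists 1, g; rewrite rmorph1 div1r.
by apply: poly_of_coefs => // i; exact/con_cst/inC/ABf.
Qed.

Lemma con_prime Q : prime_ideal S Q -> prime_ideal D (con Q).
Proof.
move=> [[[dQ QS] Q1] prQ]; split.
  by split; [exact: ideal_con | rewrite -(rmorph1 tofrac) => /con_cst; rewrite cst1].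
move=> _ _ [a ->] [b ->]; rewrite -tofracM => /con_cst; rewrite cstM.
move=> /(prQ _ _ (RangleX_tofrac _) (RangleX_tofrac _))[Qa|Qb]; [left|right]; exact/con_cst.
Qed.

Lemma t_prime_con Q : PvMD D -> prime_ideal S Q -> nonzero Q -> t_prime D (con Q).
Proof.
move=> pv pQ Q0; have [properQ _] := pQ; have [idQ _] := properQ.
split; first exact: con_prime.
by apply: w_ideal_t_ideal => //; exact: w_ideal_con.
Qed.

Lemma ext_t_prime P : t_prime D P ->
  [/\ prime_ideal S (ext P), nonzero (ext P) & con (ext P) = P].
Proof.
move=> tP; have [M [tM PM]] := t_prime_sub_t_maximal hD tP.
have [pP tiP] := tP; have [idP [P0 _]] := tiP; split.
- exact: ext_prime PM.
- exact: nonzero_ext.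
- exact/con_ext_w/t_ideal_w_ideal.
Qed.

Lemma ext_wcl A : PvMD D -> ideal D A -> ext (wcl D A) = ext A.
Proof.
by move=> pv idA; rewrite -con_ext // ext_con //; apply: ideal_ext; case: idA.
Qed.

(** * Unique t-maximal ideals, strong discreteness and chain conditions *)

Lemma weakly_Matlis_iff :
  (weakly_Matlis D /\ PvMD D) <-> (h_local S /\ Prufer S).
Proof.
rewrite -PvMD_iff_Prufer /weakly_Matlis /h_local finite_character_iff.
split=> -[[fc uni] pv]; split=> //; split=> // P.
  move=> pP P0; have [M [tM PM]] := proper_sub_ext pP.1.
  split; first by exists (ext M); split=> //; exact: maximal_ext.
  move=> _ _ /maximalP[N tN ->] /maximalP[N' tN' ->] PN PN'.
  have [_ u] := uni _ (t_prime_con pv pP P0).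
  rewrite (peq_eq (u N N' tN tN' _ _)) //.
    by rewrite -(con_ext_t_maximal tN); exact: con_mono.
  by rewrite -(con_ext_t_maximal tN'); exact: con_mono.
move=> tP; split; first exact: t_prime_sub_t_maximal.
move=> M N tM tN PM PN; have [pP P0 _] := ext_t_prime tP.
have [_ u] := uni _ pP P0.
rewrite -(con_ext_t_maximal tM) -(con_ext_t_maximal tN).
by rewrite (peq_eq (u _ _ (maximal_ext tM) (maximal_ext tN) (ext_mono PM) (ext_mono PN))).
Qed.

Lemma ideal_mulm A B : ideal D A -> ideal D B -> ideal D (mulm A B).
Proof.
move=> [dA AD] [dB BD]; split; first exact: dmod_mulm.
apply: mulm_sub; first exact: dmod_self.
by move=> a b /AD Da /BD Db; exact: subringM.
Qed.

Lemma nonzero_mulm (F : fieldType) (A B : F -> Prop) :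
  nonzero A -> nonzero B -> nonzero (mulm A B).
Proof.
move=> [a [Aa a0]] [b [Bb b0]]; exists (a * b).
by rewrite mulf_neq0 //; split=> //; exact: mulm_mem.
Qed.

(** Over a PvMD the t-closure of PP is its w-closure, which is the contraction of the extension of
    PP. *)
Lemma idempotent_ext P : PvMD D -> w_ideal D P ->
  tcl D (mulm P P) = P <-> mulm (ext P) (ext P) = ext P.
Proof.
move=> pv wP; have [idP [P0 _]] := wP; have idPP := ideal_mulm idP idP.
rewrite (tcl_wcl hD hN pv idPP.1 (nonzero_mulm P0 P0)) (mulm_ext idP idP).
split=> [e|/(congr1 con)]; first by rewrite -(ext_wcl pv idPP) e.
by rewrite (con_ext idPP) (con_ext_w wP).
Qed.

Lemma strongly_discrete_iff : strongly_discrete_PvMD D <-> strongly_discrete_Prufer S.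
Proof.
rewrite /strongly_discrete_PvMD /strongly_discrete_Prufer -PvMD_iff_Prufer.
split=> -[pv sd]; split=> // P.
  move=> pP P0; have tP := t_prime_con pv pP P0; have [[idP _] _] := pP.
  move=> /peq_eq e; apply: (sd _ tP); have [_ tiP] := tP.
  have -> : tcl D (mulm (con P) (con P)) = con P; last exact: peq_refl.
  by apply/idempotent_ext; rewrite ?ext_con //; exact: t_ideal_w_ideal.
move=> tP /peq_eq e; have [pP P0 _] := ext_t_prime tP; have [_ tiP] := tP.
apply: (sd _ pP P0); have -> : mulm (ext P) (ext P) = ext P; last exact: peq_refl.
by apply/idempotent_ext => //; exact: t_ideal_w_ideal.
Qed.

Lemma radical_con J : radical_ideal S J -> radical_ideal D (con J).
Proof.
move=> [[dJ JS] radJ]; split; first exact: ideal_con.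
move=> _ n [a ->]; rewrite -tofracXn => /con_cst Jan; apply/con_cst/(radJ _ n).
  exact: RangleX_tofrac.
by rewrite /cst -tofracXn -rmorphXn.
Qed.

(** For y = f/g each coefficient f_i lies in fR<X>, by [coefs_of_poly] applied to that ideal, say
    f_i = s f = s g y. A power of y in AR<X> thus puts the same power of f_i into AR<X>, whose
    contraction is A. *)
Lemma radical_ext A : PvMD D -> w_ideal D A -> radical_ideal D A -> radical_ideal S (ext A).
Proof.
move=> pv wA [idA radA]; have [dA AD] := idA; have [dE ES] := ideal_ext dA.
split=> // _ n [f [g [Ng ->]]] Afg; apply: ext_frac => // i.
pose J (y : L) := exists2 s, S s & y = s * tofrac f.
have dJ : dmod S J.
  split.
  - by exists 0; rewrite ?mul0r //; exact: subring0 hS.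
  - move=> _ _ [s Ss ->] [t St ->]; exists (s + t); rewrite ?mulrDl //; exact: subringD.
  - move=> a _ Sa [s Ss ->]; exists (a * s); rewrite ?mulrA //; exact: subringM.
have [|s Ss sE] := coefs_of_poly pv dJ _ i (f := f).
  by exists 1; rewrite ?mul1r //; exact: subring1 hS.
apply: (radA _ n); first exact: Rdom_tofrac.
rewrite -(con_ext_w wA) -tofracXn; apply/con_cst.
have -> : cst (f`_i ^+ n.+1) = (s * tofrac g) ^+ n.+1 * (tofrac f / tofrac g) ^+ n.+1.
  rewrite -exprMn -mulrA [tofrac g * _]mulrC divfK ?tofrac_neq0 ?Nt_neq0 // -sE.
  by rewrite /cst rmorphXn tofracXn.
apply: (dmodM dE) => //; apply: subringX => //; apply: subringM => //.
exact: RangleX_tofrac.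
Qed.

Lemma psub_chain (F : fieldType) (I : nat -> F -> Prop) :
  (forall n, psub (I n) (I n.+1)) -> forall n m, (n <= m)%N -> psub (I n) (I m).
Proof.
move=> chain n m /subnK <-; elim: (m - n)%N => // k IH; rewrite addSn.
exact: psub_trans IH (chain _).
Qed.

Lemma acc_iff : PvMD D ->
  acc (fun I => radical_ideal D I /\ t_ideal D I) <-> acc (radical_ideal S).
Proof.
move=> pv; split=> accQ I radI chain.
  (* The zero ideal is radical but not a t-ideal in the sense used here. A chain of zero ideals is
     constant; any other chain is started at a nonzero member. *)
  have [[n0 I0]|I0] := EM (exists n, nonzero (I n)); last first.
    exists 0%N => m _; have Iz k x : I k x <-> x = 0.
      split=> [Ix|->]; last by have [[dI _] _] := radI k; exact: dmod0 dI.
      by apply: contrapT => /eqP x0; apply: I0; exists k, x.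
    by move=> x; rewrite !Iz.
  have chain' := psub_chain chain.
  have wI k : w_ideal D (con (I (n0 + k)%N)).
    apply: w_ideal_con => //; first by have [] := radI (n0 + k)%N.
    apply: nonzero_sub I0; apply: chain'; exact: leq_addr.
  have [|k|n hn] := accQ (fun k => con (I (n0 + k)%N)).
  - by move=> k; split; [exact: radical_con | exact: w_ideal_t_ideal].
  - by rewrite addnS; exact: con_mono.
  exists (n0 + n)%N => m nm.
  have n0m : (n0 <= m)%N := leq_trans (leq_addr n n0) nm.
  have nmn0 : (n <= m - n0)%N by rewrite leq_subRL.
  have /peq_eq := hn _ nmn0; rewrite subnKC // => e; have [idm _] := radI m; have [idn _] := radI (n0 + n)%N.
  by rewrite -(ext_con pv idm) e ext_con.
have wI k : w_ideal D (I k) by have [_ tI] := radI k; exact: t_ideal_w_ideal.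
have [|k|n hn] := accQ (fun k => ext (I k)).
- by move=> k; apply: radical_ext => //; have [] := radI k.
- exact: ext_mono.
exists n => m nm; have /peq_eq/(congr1 con) := hn m nm.
by rewrite !con_ext_w // => ->.
Qed.

Lemma generalized_Krull_iff : generalized_Krull D <-> generalized_Dedekind S.
Proof.
rewrite /generalized_Krull /generalized_Dedekind -strongly_discrete_iff.
by split=> -[sd]; have [pv _] := sd; move=> /(acc_iff pv).
Qed.

(** * The v-closure and stability under extension *)

Lemma con_vcl A : PvMD D -> ideal D A -> nonzero A -> con (vcl S (ext A)) = vcl D A.
Proof.
move=> pv idA [b' [Ab b'0]]; have [dA AD] := idA; have [b bE] := AD _ Ab.
rewrite bE tofrac_eq0 in Ab b'0; rename b'0 into b0.
have A0 := dmod0 dA.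
have bK : tofrac b != 0 :> K by rewrite tofrac_eq0.
have bL : cst b != 0 by rewrite cst_eq0.
(* Each y in (R : A) is c/b with c = y b. Multiplication by c/b sends AR<X> into R<X>, so for a in
   the v-closure of AR<X> the element a c/b lies in R<X>, hence in R_w = R. *)
apply: psub_antisym => [_ [a [-> va]] y Cy|x vx].
  have [c cE] := Cy _ Ab.
  have {cE}yE : y = tofrac c / tofrac b by rewrite -cE mulfK.
  rewrite yE mulrA -tofracM; apply: (wcl_ring hD hN); apply: ext_div_wcl => //.
  rewrite ext_Rdom cstM -mulrA; apply: va => _ [f [g [Ng Af ->]]].
  have [|f' hf'] := @poly_scale_choice (tofrac c / tofrac b) f.
    by move=> i; rewrite -yE; exact: Cy.
  exists f', g; split=> //; rewrite mulrA; congr (_ / _).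
  apply: (mulfI bL); rewrite mulrA [cst b * _]mulrC divfK // /cst -!tofracM; congr (tofrac _).
  apply/polyP => i; rewrite !coefCM; apply/eqP; rewrite -tofrac_eq !tofracM hf'.
  by rewrite mulrA [tofrac b * _]mulrC divfK.
have [a xE] : D x.
  by apply: (vcl_sub_ring _ vx) => //; exact: AD.
rewrite xE in vx *; apply/con_cst => h Ch.
have [f [g [Ng hb]]] := Ch _ (ext_cst A0 Ab).
have g0 := tofrac_neq0 (Nt_neq0 Ng).
have hE : h * cst b * tofrac g = tofrac f by rewrite hb divfK.
(* The y in R<X> with A y/b inside R<X> form a submodule. It contains f = h b g, hence every
   coefficient of f; so each f_i/b lies in (R : A). *)
pose T (y : L) := S y /\ forall c, A (tofrac c) -> S (cst c * y / cst b).
have dT : dmod S T.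
  split.
  - split=> [|c _]; first exact: subring0 hS.
    by rewrite mulr0 mul0r; exact: subring0 hS.
  - move=> y z [Sy hy] [Sz hz]; split=> [|c Ac]; first exact: subringD.
    by rewrite mulrDr mulrDl; apply: subringD => //; [exact: hy | exact: hz].
  - move=> s y Ss [Sy hy]; split=> [|c Ac]; first exact: subringM.
    by rewrite mulrCA -mulrA; apply: subringM => //; exact: hy.
have Tf : T (tofrac f).
  split=> [|c Ac]; first exact: RangleX_tofrac.
  rewrite -hE (mul_div_cancel (cst c) h (tofrac g) bL); apply: subringM => //; last exact: RangleX_tofrac.
  exact/Ch/ext_cst.
have Cf i : colon D A (tofrac f`_i / tofrac b).
  move=> y Ay; have [c yE] := AD y Ay; rewrite yE in Ay *.
  have [_ /(_ c Ay)] := coefs_of_poly pv dT Tf i; rewrite -cstM -ext_Rdom.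
  move=> /(ext_div_wcl b0)/(wcl_ring hD hN).
  by rewrite tofracM [tofrac c * _]mulrC mulrAC.
(* Since a is in A_v, each a f_i/b lies in R; these are the coefficients of a h g. *)
have [|f' hf'] := @poly_scale_choice (tofrac a / tofrac b) f.
  by move=> i; rewrite mulrAC -mulrA; exact/vx/Cf.
exists f', g; split=> //; apply: (mulIf g0); rewrite divfK //.
apply: (mulfI bL).
have -> : cst b * (cst a * h * tofrac g) = cst a * (h * cst b * tofrac g).
  by rewrite !mulrA [cst b * cst a]mulrC -!mulrA [cst b * (h * _)]mulrCA.
rewrite hE /cst -!tofracM; congr (tofrac _).
apply/polyP => i; rewrite !coefCM; apply/eqP; rewrite -tofrac_eq !tofracM hf'.
by rewrite mulrA [tofrac b * _]mulrC divfK.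
Qed.

Lemma divisorial_ext_iff : PvMD D -> w_divisorial D <-> divisorial_domain S.
Proof.
move=> pv; split=> [wdiv J idJ J0|div A wA].
  have [dJ JS] := idJ; have wA := w_ideal_con pv idJ J0; have [idA [A0 _]] := wA.
  have idv : ideal S (vcl S J) by split; [exact: dmod_vcl | exact: vcl_sub_ring].
  suff -> : vcl S J = J by exact: peq_refl.
  have := con_vcl pv idA A0; rewrite (ext_con pv idJ) (peq_eq (wdiv _ wA)) => e.
  by rewrite -(ext_con pv idv) e ext_con.
have [idA [A0 _]] := wA; have idE : ideal S (ext A) by apply: ideal_ext; case: idA.
have /peq_eq vE := div _ idE (nonzero_ext idA A0).
by rewrite -(con_vcl pv idA A0) vE con_ext_w.
Qed.

(** Both conditions are tested at 1 and scaled by a constant u that makes the colon modules ideals.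
    Contraction and extension then match the scaled modules B and T. *)
Lemma stable_ext A : PvMD D -> w_ideal D A ->
  peq (wcl D (mulm A (colon (Eend A) A))) (Eend A) <->
  peq (mulm (ext A) (colon (Eend (ext A)) (ext A))) (Eend (ext A)).
Proof.
move=> pv wA; have [idA [[b' [Ab b'0]] clA]] := wA; have [dA AD] := idA.
have [b bE] := AD _ Ab; rewrite bE tofrac_eq0 in Ab b'0; rename b'0 into b0.
have A0 := dmod0 dA; set J := ext A.
have dJ : dmod S J by exact: dmod_ext.
(* Closure along the maximal ideals of R<X> is trivial, which gives stability of J the same shape as
   w-stability of A. *)
have mulJ C : lclos S (maximal_ideal S) (mulm J C) = mulm J C.
  apply: psub_antisym; last exact: (sub_lclos hS maximal_prime).
  by apply: lclos_maximal; exact: dmod_mulm.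
(* The choice u = b^2 works because one factor b carries (E(A) : A) into E(A) and the second carries
   the result into A. *)
have [u uE] : exists u, u = b ^+ 2 by exists (b ^+ 2).
have u0 : u != 0 by rewrite uE expf_neq0.
have uK : tofrac u != 0 :> K by rewrite tofrac_eq0.
have uL : cst u != 0 by rewrite cst_eq0.
pose B x := colon (Eend A) A (x / tofrac u).
pose T y := colon (Eend J) J (y / cst u).
have Jb : J (cst b) by exact: ext_cst.
have idT : ideal S T.
  split; last first.
    move=> y Ty; have := Ty _ Jb _ Jb; rewrite -!mulrA -!cstM -expr2 -uE mulVf // mulr1.
    exact: ext_sub_ring.
  have [c0 cD cM] := dmod_colon J (dmod_colon J dJ).
  split=> [|y z Ty Tz|a y Sa Ty]; rewrite /T ?mul0r ?mulrDl -?mulrA //; first exact: cD.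
  exact: cM.
(* Membership says that c/u multiplies products of two elements of the ideal back into it. It
   descends from AR<X> to A because A is w-closed, and ascends through the coefficients of f h. *)
have conT : con T = B.
  apply: psub_antisym => [_ [c [-> Tc]] x Ax y Ay|x Bx].
    have [p xE] := AD x Ax; have [q yE] := AD y Ay; rewrite xE in Ax *; rewrite yE in Ay *.
    rewrite -(w_ideal_wcl wA) !(mulrAC _ (tofrac u)^-1) -!tofracM.
    apply: ext_div_wcl => //; rewrite !cstM -2!(mulrAC _ (cst u)^-1).
    by apply: Tc; exact: ext_cst.
  have [c xE] : D x.
    have := Bx _ Ab _ Ab; rewrite -!mulrA -!tofracM -expr2 -uE mulVf // mulr1; exact: AD.
  rewrite xE in Bx *; apply/con_cst => _ [f [g [Ng Af ->]]] _ [h [k [Nk Ah ->]]].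
  have Ar i : A (tofrac c / tofrac u * tofrac (f * h)`_i).
    rewrite coefM rmorph_sum mulr_sumr; apply: (dmod_sum dA) => j _.
    by rewrite rmorphM mulrA; apply: Bx; [exact: Af | exact: Ah].
  have [|r hr] := @poly_scale_choice (tofrac c / tofrac u) (f * h).
    by move=> i; exact/AD/Ar.
  exists r, (g * k); split; first exact: NtM.
    by move=> i; rewrite hr.
  rewrite -mulrA mulf_div -!tofracM mulrA; congr (_ / _); apply: (mulfI uL).
  rewrite mulrA [cst u * _]mulrC divfK // /cst -!tofracM; congr (tofrac _).
  apply/polyP => i; rewrite !coefCM; apply/eqP; rewrite -tofrac_eq !tofracM hr.
  by rewrite mulrA [tofrac u * _]mulrC divfK.
have idB : ideal D B by rewrite -conT; exact: ideal_con idT.1.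
have clA' : psub (lclos D TM A) A by move=> x /clA.
(* What remains is to compare u in (AB)_w with u in J T. As T = BR<X>, the product J T is the
   extension of AB, and its contraction is (AB)_w. *)
rewrite (lclos_stableP hD hT dA clA') (lclos_scale hT _ dA uK).
rewrite -(mulJ (colon (Eend J) J)).
rewrite (lclos_stableP hS maximal_prime dJ (lclos_maximal dJ)).
rewrite (lclos_scale maximal_prime _ dJ uL) mulJ.
rewrite -/B -/T -[lclos D TM _]/(wcl D (mulm A B)) -(con_ext (ideal_mulm idA idB)).
by rewrite con_cst -(mulm_ext idA idB) -conT (ext_con pv idT).
Qed.

Lemma stable_ext_iff : PvMD D -> w_stable D <-> stable_domain S.
Proof.
move=> pv; split=> [wst J idJ J0|st A wA].
  by have := wst _ (w_ideal_con pv idJ J0) => /(stable_ext pv (w_ideal_con pv idJ J0));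
    rewrite ext_con.
have [idA [A0 _]] := wA; apply/stable_ext => //.
by apply: st; [apply: ideal_ext; case: idA | exact: nonzero_ext].
Qed.

(** * Integral closedness with divisoriality and with stability *)

Lemma lclos_maximal_ring : psub (lclos S (maximal_ideal S) S) S.
Proof. exact: lclos_maximal (dmod_self hS). Qed.

Lemma Prufer_integrally_closed : Prufer S -> integrally_closed S.
Proof.
exact: (locally_valuation_integrally_closed hS maximal_prime lclos_maximal_ring).
Qed.

Lemma w_divisorial_iff :
  (integrally_closed D /\ w_divisorial D) <->
  (integrally_closed S /\ divisorial_domain S).
Proof.
split=> -[ic div].
  have pv : PvMD D.
    apply: (divisorial_valuation hD hT (wcl_ring hD hN) Rdom_frac ic) => I idI I0 clI.
    exact: div.
  split; first by apply/Prufer_integrally_closed/PvMD_iff_Prufer.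
  exact/(divisorial_ext_iff pv).
have pr : Prufer S.
  apply: (divisorial_valuation hS maximal_prime lclos_maximal_ring RangleX_frac ic).
  by move=> I idI I0 _; exact: div.
have pv : PvMD D by exact/PvMD_iff_Prufer.
split; first exact: PvMD_integrally_closed.
exact/(divisorial_ext_iff pv).
Qed.

Lemma w_stable_iff :
  (integrally_closed D /\ w_stable D) <-> (integrally_closed S /\ stable_domain S).
Proof.
split=> -[ic st].
  have pv : PvMD D.
    apply: (stable_valuation hD hT (wcl_ring hD hN) Rdom_frac ic) => I idI I0 clI.
    exact: st.
  split; first by apply/Prufer_integrally_closed/PvMD_iff_Prufer.
  exact/(stable_ext_iff pv).
have pr : Prufer S.
  apply: (stable_valuation hS maximal_prime lclos_maximal_ring RangleX_frac ic).
  move=> I idI I0 _; suff -> : forall C, lclos S (maximal_ideal S) (mulm I C) = mulm I C.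
    exact: st.
  move=> C; have [dI _] := idI; apply: psub_antisym.
    by apply: lclos_maximal; exact: dmod_mulm.
  exact: (sub_lclos hS maximal_prime).
have pv : PvMD D by exact/PvMD_iff_Prufer.
split; first exact: PvMD_integrally_closed.
exact/(stable_ext_iff pv).
Qed.

End Nagata.

Theorem theorem2p12 (R : idomainType)
  (hR : exists x : R, x != 0 /\ x \notin GRing.unit) :
     (t_finite_character (@Rdom R) <-> finite_character (@RangleX R)) /\
      ((weakly_Matlis (@Rdom R) /\ PvMD (@Rdom R)) <->
        (h_local (@RangleX R) /\ Prufer (@RangleX R))) /\
      (strongly_discrete_PvMD (@Rdom R) <-> strongly_discrete_Prufer (@RangleX R)) /\
      (generalized_Krull (@Rdom R) <-> generalized_Dedekind (@RangleX R)) /\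
      ((integrally_closed (@Rdom R) /\ w_divisorial (@Rdom R)) <->
        (integrally_closed (@RangleX R) /\ divisorial_domain (@RangleX R))) /\
      ((integrally_closed (@Rdom R) /\ w_stable (@Rdom R)) <->
        (integrally_closed (@RangleX R) /\ stable_domain (@RangleX R))).
Proof.
split; first exact: finite_character_iff.
split; first exact: weakly_Matlis_iff.
split; first exact: strongly_discrete_iff.
split; first exact: generalized_Krull_iff.
split; first exact: w_divisorial_iff.
exact: w_stable_iff.
Qed.
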